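(* Let $(\Omega,\Sigma,\mu)$ be a finite measure space, let $Z$ be a real Banach space and let $X\subseteq Z^*$ be a norm-closed subspace which is norming for $Z$. Suppose that $(B_{X^*},w^* )$ is convex block compact and that $(X,\mu(X,Z))$ is complete. If $\nu:\Sigma\to Z^*$ is a countably additive $\mu$-continuous vector measure such that $$\overline{\mathrm{co}(\mathcal{A}_\nu(A))}^{w^*}\cap X\neq\emptyset\quad\text{for every }A\in\Sigma\text{ with }\mu(A)>0,$$ then $\nu(\Sigma)\subseteq X$, i.e. $\nu(A)\in X$ for every $A\in\Sigma$.
   Context: A subspace $X\subseteq Z^*$ is norming for $Z$ if the formula $|||z|||=\sup\{\langle x,z\rangle: x\in B_X\}$ defines an equivalent norm on $Z$, where $B_X$ is the closed unit ball of $X$ and $\langle z^*,z\rangle$ denotes the evaluation of $z^*\in Z^*$ at $z\in Z$. $\sigma(Z,X)$ is the topology on $Z$ of pointwise convergence on $X$. $\mu(X,Z)$ (not to be confused with the measure $\mu$) is the Mackey topology on $X$ associated to the dual pair $\langle X,Z\rangle$, i.e. the topology on $X$ of uniform convergence on all absolutely convex $\sigma(Z,X)$-compact subsets of $Z$; completeness is that of a locally convex space (every Cauchy net converges). A convex block subsequence of a sequence $(g_n)_{n\in\mathbb{N}}$ in a linear space is a sequence $(h_k)_{k\in\mathbb{N}}$ of the form $h_k=\sum_{n\in I_k}a_n g_n$, where $(I_k)_{k\in\mathbb{N}}$ is a sequence of finite subsets of $\mathbb{N}$ with $\max(I_k)<\min(I_{k+1})$ and $(a_n)_{n\in\mathbb{N}}$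 is a sequence of non-negative real numbers such that $\sum_{n\in I_k}a_n=1$ for all $k\in\mathbb{N}$. $(B_{X^*},w^* )$ (the closed unit ball of $X^*$ with the weak$^*$ topology) is convex block compact if every sequence in $B_{X^*}$ admits a convex block subsequence which is weak$^*$-convergent. Countable additivity and $\mu$-continuity of $\nu$ are with respect to the norm of $Z^*$ ($\mu$-continuous: $\|\nu(A)\|\to 0$ as $\mu(A)\to 0$). For $A\in\Sigma$ with $\mu(A)>0$, the average range is $$\mathcal{A}_\nu(A):=\Big\{\frac{\nu(B)}{\mu(B)}: B\in\Sigma,\ B\subseteq A,\ \mu(B)>0\Big\}.$$ $\mathrm{co}$ denotes convex hull and, for subsets of $Z^*$, $\overline{\,\cdot\,}^{w^*}$ denotes closure for the weak$^*$ topology $\sigma(Z^*,Z)$. *)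

(* Defs.v *)
From HB Require Import structures.
From mathcomp Require Import all_boot all_order all_algebra finmap.
From mathcomp Require Import all_classical all_reals all_analysis.

Set Implicit Arguments.
Unset Strict Implicit.
Unset Printing Implicit Defensive.

Import Order.TTheory GRing.Theory Num.Theory.
Import numFieldNormedType.Exports.

Local Open Scope classical_set_scope.
Local Open Scope ring_scope.

Section Dual.
Context {R : realType} (V : normedModType R).

Definition is_dual : {pred V -> R^o} :=
  fun f => `[< linear f /\ continuous f >].

Record dual := Dual { dual_fun :> V -> R^o; _ : dual_fun \in is_dual }.

HB.instance Definition _ := [isSub for dual_fun].
HB.instance Definition _ := [Choice of dual by <:].

Lemma is_dual_submod_closed : submod_closed is_dual.
Proof.
split.
  apply/asboolP; split=> [a u v|]; last exact: cst_continuous.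
  by rewrite scaler0 addr0.
move=> a f g /asboolP[lf cf] /asboolP[lg cg]; apply/asboolP; split.
  move=> b u v; rewrite !fctE lf lg !scalerDr !scalerA (mulrC a b).
  by rewrite -!addrA; congr (_ + _); rewrite !addrA; congr (_ + _); rewrite addrC.
by move=> z; apply: cvgD (cg z); apply: cvgZl_tmp; exact: cf.
Qed.

HB.instance Definition _ :=
  GRing.isSubmodClosed.Build R (V -> R^o) is_dual is_dual_submod_closed.
HB.instance Definition _ := [SubChoice_isSubLmodule of dual by <:].

Implicit Types f g : dual.

Lemma dual_is_linear f : linear f.
Proof. by case: f => f /= /asboolP[]. Qed.

HB.instance Definition _ f := GRing.isLinear.Build R V R^o *:%R f
  (dual_is_linear f).

Lemma dual_continuous f : continuous f.
Proof. by case: f => f /= /asboolP[]. Qed.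

Definition dual_norm f : R :=
  sup [set `|f z| | z in [set z : V | `|z| <= 1]].

Lemma dual_norm_has_sup f : has_sup [set `|f z| | z in [set z : V | `|z| <= 1]].
Proof.
split; first by exists `|f 0|, 0 => //=; rewrite normr0.
have := @continuous_linear_bounded _ _ _ 0 f (@dual_continuous f 0).
move/linear_boundedP => [M [_ /(_ (M + 1))]].
rewrite ltrDl ltr01 => /(_ isT) Mf; exists (`|M + 1|) => _ [z z1 <-].
apply: (le_trans (Mf z)); rewrite (le_trans (ler_norm _))// normrM normr_id.
by rewrite ler_piMr.
Qed.

Lemma dual_norm_ge f z : `|z| <= 1 -> `|f z| <= dual_norm f.
Proof. by move=> z1; apply: sup_upper_bound (dual_norm_has_sup f) _ _; exists z. Qed.

Lemma dual_norm_le f (C : R) :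
  (forall z, `|z| <= 1 -> `|f z| <= C) -> dual_norm f <= C.
Proof.
move=> fC; apply: ge_sup; first by case: (dual_norm_has_sup f).
by move=> _ [z z1 <-]; exact: fC.
Qed.

Lemma dual_normD f g : dual_norm (f + g) <= dual_norm f + dual_norm g.
Proof.
apply: dual_norm_le => z z1; apply: (le_trans (ler_normD (f z) (g z))).
by rewrite lerD// dual_norm_ge.
Qed.

Lemma dual_normZ (a : R) f : dual_norm (a *: f) = `|a| * dual_norm f.
Proof.
have le b h : dual_norm (b *: h) <= `|b| * dual_norm h.
  apply: dual_norm_le => z z1.
  by rewrite [X in `|X|](_ : _ = b *: h z)// normrZ ler_wpM2l// dual_norm_ge.
apply/eqP; rewrite eq_le le/=.
have [->|a0] := eqVneq a 0.
  by rewrite normr0 mul0r (le_trans (normr_ge0 ((0 *: f) 0)))// dual_norm_ge ?normr0.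
rewrite -ler_pdivlMl ?normr_gt0// -normfV (le_trans _ (le _ _))//.
by rewrite scalerA mulVf// scale1r.
Qed.

Lemma dual_norm0_eq0 f : dual_norm f = 0 -> f = 0.
Proof.
move=> f0; apply/val_inj/funext => z /=.
have [->|z0] := eqVneq z 0; first by rewrite linear0.
have : `|f (`|z|^-1 *: z)| <= 0.
  by rewrite -f0 dual_norm_ge// normrZ normfV normr_id mulVf// normr_eq0.
rewrite normr_le0 linearZ /= scaler_eq0 invr_eq0 normr_eq0 (negbTE z0)/=.
by move=> /eqP.
Qed.

HB.instance Definition _ := Lmodule_isNormed.Build R dual
  dual_normD dual_normZ dual_norm0_eq0.

End Dual.

Section Subspace.
Context {R : realType} (V : normedModType R) (X : submodClosed V).

Record subsp := Subsp { subsp_val :> V; _ : subsp_val \in X }.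

HB.instance Definition _ := [isSub for subsp_val].
HB.instance Definition _ := [Choice of subsp by <:].
HB.instance Definition _ := [SubChoice_isSubLmodule of subsp by <:].

Let norm (x : subsp) : R := `|val x|.

Let normD x y : norm (x + y) <= norm x + norm y.
Proof. exact: ler_normD. Qed.

Let normZ (a : R) x : norm (a *: x) = `|a| * norm x.
Proof. exact: normrZ. Qed.

Let norm0_eq0 x : norm x = 0 -> x = 0.
Proof. by move=> /normr0_eq0 x0; exact: val_inj. Qed.

HB.instance Definition _ := Lmodule_isNormed.Build R subsp
  normD normZ norm0_eq0.

End Subspace.

Section DualPair.
Context {R : realType} (Z : normedModType R).

Definition weak_star : Type :=
  initial_topology ((fun f : dual Z => f : Z -> R) : dual Z -> {ptws Z -> R}).

HB.instance Definition _ := Uniform.on weak_star.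

Variable X : submodClosed (dual Z).

(* The topology $\sigma(Z,X)$ on [Z]. *)
Definition sigma_top : Type :=
  initial_topology
    ((fun (z : Z) (x : subsp X) => subsp_val x z) : Z -> {ptws subsp X -> R}).

HB.instance Definition _ := Uniform.on sigma_top.

Definition absolutely_convex (K : set Z) :=
  convex_set K /\ (forall (a : R) z, `|a| <= 1 -> K z -> K (a *: z)).

Definition abs_convex_sigma_compact : set (set Z) :=
  [set K | absolutely_convex K /\ compact (K : set sigma_top)].

(* The Mackey topology $\mu(X,Z)$ on [X]. *)
Definition mackey : Type :=
  initial_topology ((fun x : subsp X => subsp_val x : Z -> R) :
    subsp X -> {family abs_convex_sigma_compact, Z -> R}).

HB.instance Definition _ := Uniform.on mackey.

Definition is_norm (N : Z -> R) :=
  [/\ forall y z, N (y + z) <= N y + N z,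
      forall a z, N (a *: z) = `|a| * N z &
      forall z, N z = 0 -> z = 0].

Definition equivalent_norm (N : Z -> R) :=
  is_norm N /\ exists c C : R,
    [/\ 0 < c, 0 < C & forall z, c * `|z| <= N z <= C * `|z|].

Definition norming :=
  equivalent_norm
    (fun z => sup [set x z | x in [set x : dual Z | x \in X /\ `|x| <= 1]]).

End DualPair.

(* Completeness stated with Cauchy filters, which is equivalent to
   completeness with Cauchy nets. *)
Definition complete_uniform (T : uniformType) :=
  forall F : set_system T, ProperFilter F -> cauchy F -> exists x : T, F --> x.

(* The sets [I k] are nonempty because the weights sum to 1 over each of them,
   so the condition on consecutive sets says [max (I k) < min (I k.+1)]. *)
Definition convex_block_subsequence {R : realType} (E : lmodType R)
    (g h : nat -> E) :=
  exists (I : nat -> {fset nat}) (a : nat -> R),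
    [/\ forall k m n, m \in I k -> n \in I k.+1 -> (m < n)%N,
        forall n, 0 <= a n,
        forall k, \sum_(n <- I k) a n = 1 &
        forall k, h k = \sum_(n <- I k) a n *: g n].

Definition dual_ball_convex_block_compact {R : realType} (V : normedModType R) :=
  forall g : nat -> dual V, (forall n, `|g n| <= 1) ->
  exists2 h : nat -> dual V, convex_block_subsequence g h &
    exists l : weak_star V, (h : nat -> weak_star V) @ \oo --> l.

Definition convex_hull {R : realType} (E : lmodType R) (A : set E) : set E :=
  smallest (@convex_set R E) A.

Section VectorMeasure.
Context {R : realType} (d : measure_display) (Omega : measurableType d).
Context (E : normedModType R).
Variables (mu : set Omega -> \bar R) (nu : set Omega -> E).

Definition countably_additive :=
  forall F : nat -> set Omega, (forall n, measurable (F n)) ->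
  trivIset setT F ->
  (fun n => \sum_(0 <= i < n) nu (F i)) @ \oo --> nu (\bigcup_n F n).

Definition measure_continuous :=
  forall e : R, 0 < e -> exists2 delta : R, 0 < delta &
  forall A, measurable A -> (mu A < delta%:E)%E -> `|nu A| < e.

Definition average_range (A : set Omega) : set E :=
  [set (fine (mu B))^-1 *: nu B | B in
    [set B | [/\ measurable B, B `<=` A & (0 < mu B)%E]]].

End VectorMeasure.

(* Main.v *)
Require Import Defs.
From HB Require Import structures.
From mathcomp Require Import all_boot all_order all_algebra finmap.
From mathcomp Require Import all_classical all_reals all_analysis.
From mathcomp Require Import measurable_realfun ring lra.

Set Implicit Arguments.
Unset Strict Implicit.
Unset Printing Implicit Defensive.

Import Order.TTheory GRing.Theory Num.Theory.
Import numFieldNormedType.Exports.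

Local Open Scope classical_set_scope.
Local Open Scope ring_scope.

(** Let [phi = nu A0].  Completeness of [X] for the Mackey topology reduces
    [phi \in X] to uniform approximation: for every absolutely convex
    sigma(Z,X)-compact [K] and every [eta > 0], some [x] in [X] satisfies
    [|phi - x| <= 2 eta] on [K] ([mackey_complete_mem]).

    Suppose that no such [x] exists.  A separation argument in finite dimension
    ([finite_separation]) then shows that for every finite [s] in [X] the convex
    set [C s] of those [z] in [K] with [phi z >= eta] and [|x z| <= 1] for all
    [x] in [s] is nonempty.  Every [z] in [Z] gives a scalar measure
    [A |-> nu A z] with a Radon-Nikodym density [f z], and [z |-> f z] is linear
    up to null sets.  Since [K] is norm bounded ([sigma_compact_bounded]) and
    the range of [nu] is norm bounded ([measure_continuous_bounded]), the
    densities of the points of [K] are bounded in L1.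

    The idea is to let [s] grow and to choose points of [C s] that almost
    minimise the integral of [sqrt (1 + f z ^ 2)].  This integrand grows
    linearly, so the integral is bounded on [K], and it is strictly convex with
    an explicit gap at midpoints ([arclen_gap]); so almost minimisers that are
    allowed to compete with each other have densities that are close in measure.
    One gets a sequence [z n] whose densities converge almost everywhere in
    [-oo, +oo].  As [phi (z n) >= eta] while [nu] is mu-continuous, the densities
    must be eventually above some [c > 0] on a set [A] of positive measure
    ([eventually_small_value]).

    Only now is an element [x] of [X] chosen in the weak* closed convex hull of
    the average range of [nu] over [A].  Repeating the minimisation with the
    further constraint [|x z| <= 1 / (n + 1)] gives points [z' n] with the same
    asymptotic densities on [A].  Let [y] be a sigma(Z,X)-cluster point of
    [z' n] in [K]; then [x y = 0].  On the other hand the density of [y] is at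
    least [c / 4] almost everywhere on [A]: otherwise, on a set of positive
    measure, it is below [c / 4] while the densities of all [z' m] with [m >= n]
    exceed [c / 2], and an element [g] of [X] in the average range hull of that
    set satisfies both [g y <= c / 4] and [g (z' m) >= c / 2] for [m >= n],
    which contradicts clustering.  Hence [x y >= c / 4], a contradiction
    ([compact_approximation]). *)

(** * Weak topologies *)

Section InitialTopologies.

Lemma cvg_to_cauchy (T : uniformType) (F : set_system T) (l : T) :
  Filter F -> F --> l -> cauchy F.
Proof.
move=> FF Fl A entA; have /entourage_split_ex [B entB sB2A] := entA.
exists (xsection (B^-1%relation) l, xsection B l).
  split=> /=; apply: Fl; rewrite /= -nbhs_entourageE; last by exists B.
  by exists B^-1%relation => //; exact: entourage_inv.
by move=> ab [/= /xsectionP Ba /xsectionP Bb]; apply: sB2A; exists l.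
Qed.

Lemma cvg_initial (S : choiceType) (T : topologicalType) (f : S -> T)
    (F : set_system S) (s : S) : Filter F ->
  f @ F --> f s -> F --> (s : initial_topology f).
Proof.
move=> FF fF A /= [_ [[B Bop <-] Bfs] sBA]; apply: filterS sBA _.
by apply: fF; exact: open_nbhs_nbhs.
Qed.

Context {R : realType} (Z : normedModType R) (X : submodClosed (dual Z)).
Implicit Types (F : set_system Z) (z : Z).

Lemma cvg_sigmaP F z : Filter F ->
  F --> (z : sigma_top X) <-> forall x : subsp X, subsp_val x @ F --> subsp_val x z.
Proof.
move=> FF; split=> [Fz x|Fz].
  have := cvg_comp _ _ Fz (@initial_continuous _ _ _ (z : sigma_top X)).
  by move=> /pointwise_cvgP/(_ x).
apply: cvg_initial; apply/(@pointwise_cvgP (subsp X) R) => x; exact: Fz.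
Qed.

Lemma weak_star_eval_continuous z :
  continuous ((fun f : dual Z => f z : R) : weak_star Z -> R).
Proof.
move=> f.
have : {ptws, (fun g : dual Z => g : Z -> R) @ nbhs (f : weak_star Z) --> (f : Z -> R)}.
  exact: (@initial_continuous _ _
    ((fun f : dual Z => f : Z -> R) : dual Z -> {ptws Z -> R}) f).
by move=> /pointwise_cvgP/(_ z).
Qed.

End InitialTopologies.

(** * Norms on the dual and completeness of closed subspaces *)

Section DualNorm.
Context {R : realType} (Z : normedModType R).
Implicit Types (f : dual Z) (z : Z).

Lemma dual_addE (f g : dual Z) z : (f + g) z = f z + g z.
Proof. by []. Qed.

Lemma dual_scaleE (a : R) (f : dual Z) z : (a *: f) z = a * f z.
Proof. by []. Qed.

Lemma dual_bound f z : `|f z| <= `|f| * `|z|.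
Proof.
have [->|z0] := eqVneq z 0; first by rewrite linear0 !normr0 mulr0.
have nz : 0 < `|z| by rewrite normr_gt0.
rewrite -ler_pdivrMr// mulrC -[X in X * _]gtr0_norm ?invr_gt0//.
rewrite -[leLHS](normrZ _ (f z : R^o)) -linearZ.
by apply: dual_norm_ge; rewrite normrZ normfV normr_id mulVf// gt_eqF.
Qed.

Lemma dual_norm_leP f (C : R) : 0 <= C ->
  (forall z, `|f z| <= C * `|z|) -> `|f| <= C.
Proof.
move=> C0 fC; apply: dual_norm_le => z z1; apply: (le_trans (fC z)).
by rewrite ler_piMr.
Qed.

Definition dual_of_bounded (l : Z -> R^o) (C : R) (ll : linear l)
    (lC : forall z, `|l z| <= C * `|z|) : dual Z.
Proof.
apply: (@Dual _ _ l); apply/asboolP; split=> //.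
pose L : {linear Z -> R^o} := HB.pack l (GRing.isLinear.Build _ _ _ _ _ ll).
have Lb : bounded_near L (nbhs 0).
  apply/linear_boundedP; exists C; split; first exact: num_real.
  by move=> r Cr z; apply: (le_trans (lC z)); rewrite ler_wpM2r// ltW.
exact: (@linear_bounded_continuous _ _ _ L).1 Lb.
Defined.

Lemma dual_eval_continuous (z : Z) : continuous (fun f : dual Z => f z : R).
Proof.
move=> f; have nbhs_f : Filter (nbhs f) := nbhs_filter f.
apply/(@cvgrPdist_le _ _ _ (nbhs f) nbhs_f) => e e0.
have d0 : 0 < e / (`|z| + 1) by rewrite divr_gt0// ltr_wpDl.
have fd := nbhsx_ballx f _ d0.
apply: (@filterS _ (nbhs f) _ _ _ _ fd) => g; rewrite -ball_normE /= => fg.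
have -> : (f z : R) - g z = (f - g) z by [].
apply: (le_trans (dual_bound _ _)).
move: fg; rewrite ltr_pdivlMr ?ltr_wpDl// => /ltW; apply: le_trans.
by rewrite ler_wpM2l// lerDl.
Qed.

End DualNorm.

Section SubspaceEvaluation.
Context {R : realType} (Z : normedModType R) (X : submodClosed (dual Z)).

Lemma subsp_scaleE (a : R) (x : subsp X) z : subsp_val (a *: x) z = a * subsp_val x z.
Proof.
have -> : subsp_val (a *: x) = a *: subsp_val x.
  exact: (linearZ_LR (val : subsp X -> dual Z)).
exact: dual_scaleE.
Qed.

Lemma subsp_eval_linear (z : Z) : linear (fun x : subsp X => subsp_val x z : R^o).
Proof.
move=> a x y.
have -> : subsp_val (a *: x + y) = a *: subsp_val x + subsp_val y.
  exact: (linearP (val : subsp X -> dual Z)).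
by rewrite dual_addE dual_scaleE.
Qed.

End SubspaceEvaluation.

Section SubspaceComplete.
Context {R : realType} (Z : normedModType R) (X : submodClosed (dual Z)).
Hypothesis X_closed : closed [set x : dual Z | x \in X].

(** The limit is built pointwise on [Z]; a Cauchy filter contains a ball, which
    bounds the pointwise limit, and uniform estimates on balls upgrade the
    convergence to the norm.  Closedness of [X] keeps the limit inside. *)
Lemma subsp_cauchy_cvg (F : set_system (subsp X)) :
  ProperFilter F -> cauchy F -> cvg F.
Proof.
move=> FF /cauchyP cF.
have Fz z : cvg ((fun x : subsp X => subsp_val x z : R) @ F).
  apply/cauchy_cvgP/cauchyP => e e0.
  have d0 : 0 < e / (`|z| + 1) by rewrite divr_gt0// ltr_wpDl.
  have [x Fx] := cF _ d0; exists (subsp_val x z).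
  change (F ((fun y : subsp X => subsp_val y z : R) @^-1` ball (subsp_val x z : R) e)).
  apply: filterS Fx => y; rewrite /= -!ball_normE /= => xy.
  rewrite (_ : _ - _ = (subsp_val (x - y) : dual Z) z)//.
  apply: (le_lt_trans (dual_bound _ _)).
  move: xy; rewrite ltr_pdivlMr ?ltr_wpDl// => /le_lt_trans; apply.
  by rewrite ler_wpM2l// lerDl.
pose l z : R^o := lim ((fun x : subsp X => subsp_val x z : R) @ F).
have ll : linear l.
  move=> a u v; apply: cvg_lim => //.
  rewrite [X in X @ F](_ : _ = fun x : subsp X => a *: (subsp_val x u : R^o) + subsp_val x v).
    by apply: cvgD; [apply: cvgZl_tmp; exact: Fz|exact: Fz].
  by apply/funext => x; rewrite linearP.
have lx x e z : F (ball x e) -> `|l z - subsp_val x z| <= e * `|z|.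
  move=> Fx; have cF' : (fun y : subsp X => `|(subsp_val y z : R) - subsp_val x z|) @ F
      --> `|l z - subsp_val x z|.
    by apply: cvg_norm; apply: cvgB; [exact: Fz|exact: cvg_cst].
  apply: (closed_cvg (fun r : R => r <= e * `|z|)) cF'; first exact: closed_le.
  near=> y; have : ball x e y by near: y.
  rewrite -!ball_normE /= => xy.
  rewrite (_ : _ - _ = (subsp_val (y - x) : dual Z) z)//.
  by apply: (le_trans (dual_bound _ _)); rewrite ler_wpM2r// -normrN opprB ltW.
have [x1 Fx1] := cF 1 ltr01.
have lb z : `|l z| <= (1 + `|x1|) * `|z|.
  rewrite -(subrK (subsp_val x1 z) (l z)) mulrDl (le_trans (ler_normD _ _))//.
  by rewrite lerD ?lx// (le_trans (dual_bound _ _)).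
pose L := dual_of_bounded ll lb.
have Lx x e : 0 <= e -> F (ball x e) -> `|L - subsp_val x| <= e.
  by move=> e0 Fx; apply: dual_norm_leP => // z; exact: lx.
have LX : L \in X.
  have : [set x : dual Z | x \in X] L; last by [].
  apply: X_closed => /= B /nbhs_ballP[e /= e0 eB].
  have e2 : 0 < e / 2 by rewrite divr_gt0.
  have [x Fx] := cF _ e2.
  exists (subsp_val x); split; first by case: x {Fx}.
  apply: eB; rewrite -ball_normE /=.
  by rewrite (le_lt_trans (Lx x _ _ Fx))// ?ltW ?divr_gt0// ltr_pdivrMr// ltr_pMr// ltr1n.
apply/cvg_ex; exists (Subsp LX); apply/cvgrPdist_le => e e0.
have e2 : 0 < e / 2 by rewrite divr_gt0.
have [x Fx] := cF _ e2.
apply: filterS (Fx) => y; rewrite -ball_normE /= => xy.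
rewrite -(subrKA x) (le_trans (ler_normD _ _))// [leRHS](splitr e) lerD//; last exact: ltW.
by apply: (Lx x) => //; exact: ltW.
Unshelve. all: by end_near. Qed.

End SubspaceComplete.

(** * The dual pair of X and Z *)

Section ConvexSets.
Context {R : realType} (E : lmodType R).

Lemma convex_setE (A : set E) :
  convex_set (A : set (convex_lmodType E)) <->
  forall y z (t : R), 0 <= t <= 1 -> A y -> A z -> A (t *: y + (1 - t) *: z).
Proof.
split=> [cA y z t /andP[t0 t1] Ay Az|cA y z t /[!inE] Ay Az].
  by have := cA y z (Itv01 t0 t1); rewrite !inE; apply.
by apply: cA => //; apply/andP; split.
Qed.

End ConvexSets.

Section DualPairTopology.
Context {R : realType} (Z : normedModType R) (X : submodClosed (dual Z)).

(** A weak* closed half-space defined by a point of [Z] is closed and convex,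
    so it contains the closed convex hull of each of its subsets. *)
Lemma closure_convex_hull_ge (S : set (dual Z)) (z : Z) (c : R) (f : dual Z) :
  (forall g, S g -> c <= g z) ->
  closure (convex_hull S : set (weak_star Z)) f -> c <= f z.
Proof.
move=> Sc; pose H : set (weak_star Z) := [set g : dual Z | c <= g z].
have H_closed : closed H.
  apply: (@closed_comp (weak_star Z) R (fun g : dual Z => g z : R) [set r | c <= r]).
    by move=> g _; exact: weak_star_eval_continuous.
  exact: closed_ge.
have hullH : (convex_hull S : set (weak_star Z)) `<=` H.
  apply: smallest_sub => //; apply/convex_setE => g h t /andP[t0 t1] /= cg ch.
  change (c <= t * g z + (1 - t) * h z).
  rewrite -[leLHS](subrK (t * c)) addrC -{2}[c]mul1r -mulrBl.
  by rewrite lerD// ler_wpM2l// subr_ge0.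
by move=> /(closure_subset hullH); rewrite -(closure_id H).1.
Qed.

Lemma closure_convex_hull_le (S : set (dual Z)) (z : Z) (c : R) (f : dual Z) :
  (forall g, S g -> g z <= c) ->
  closure (convex_hull S : set (weak_star Z)) f -> f z <= c.
Proof.
move=> Sc Sf; rewrite -lerN2 -[leRHS]linearN.
by apply: closure_convex_hull_ge Sf => g /Sc; rewrite linearN lerN2.
Qed.

Lemma sigma_eval_continuous (x : subsp X) :
  continuous (fun z : sigma_top X => subsp_val x z : R).
Proof.
move=> z.
have [h _] := @cvg_sigmaP _ _ X (nbhs (z : sigma_top X)) z (@nbhs_filter (sigma_top X) z).
exact: h (@cvg_id _ _) x.
Qed.

Lemma sigma_continuous (T : topologicalType) (f : T -> Z) :
  (forall x : subsp X, continuous (fun t => subsp_val x (f t) : R)) ->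
  continuous (f : T -> sigma_top X).
Proof.
move=> fx t.
have [_ h] := @cvg_sigmaP _ _ X ((f : T -> sigma_top X) @ t) (f t)
  (fmap_filter (f : T -> sigma_top X) _).
by apply: h => x; exact: fx.
Qed.

(** Compactness for sigma(Z,X) gives cluster points of sequences and in general
    no convergent subsequences: [n] depends on [x]. *)
Lemma sigma_compact_cluster (K : set Z) (u : nat -> Z) :
  compact (K : set (sigma_top X)) -> (forall n, K (u n)) ->
  exists2 z, K z & forall (x : subsp X) (e : R) (n0 : nat), 0 < e ->
    exists2 n, (n0 <= n)%N & `|subsp_val x (u n) - subsp_val x z| < e.
Proof.
move=> cK Ku.
have uK : ((u : nat -> sigma_top X) @ \oo) K by exists 0%N => // n _; exact: Ku.
have [z [Kz uz]] := cK _ _ uK.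
exists z => // x e n0 e0.
have un0 : ((u : nat -> sigma_top X) @ \oo) [set u n | n in [set n | (n0 <= n)%N]].
  by exists n0 => // n /= n0n; exists n.
have zx : nbhs (z : sigma_top X) [set w | `|subsp_val x z - subsp_val x w| < e].
  by have /cvgrPdist_lt := @sigma_eval_continuous x z; apply.
by have [_ [[n n0n <-] h]] := uz _ _ un0 zx; exists n; rewrite // distrC.
Qed.

Lemma abs_convex0 (K : set Z) z : absolutely_convex K -> K z -> K 0.
Proof. by move=> [_ /(_ 0 z)]; rewrite normr0 scale0r ler01; exact. Qed.

Lemma abs_convexN (K : set Z) z : absolutely_convex K -> K z -> K (- z).
Proof. by move=> [_ /(_ (-1) z)]; rewrite normrN1 scaleN1r lexx; exact. Qed.

(** Sums of two members make the family that defines the Mackey topology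
    directed upwards, since each member that is nonempty contains 0. *)
Lemma abs_convex_sigma_compactD (K L : set Z) :
  abs_convex_sigma_compact X K -> abs_convex_sigma_compact X L ->
  abs_convex_sigma_compact X [set y.1 + y.2 | y in K `*` L].
Proof.
move=> [[cK bK] kK] [[cL bL] kL]; split.
  split.
    apply/convex_setE => _ _ t t01 [[y1 y2] [/= Ky1 Ly2] <-] [[z1 z2] [/= Kz1 Lz2] <-].
    exists (t *: y1 + (1 - t) *: z1, t *: y2 + (1 - t) *: z2) => /=.
      by split => /=; [exact: (convex_setE K).1|exact: (convex_setE L).1].
    by rewrite !scalerDr addrACA.
  move=> a _ a1 [[y1 y2] [/= Ky1 Ly2] <-].
  exists (a *: y1, a *: y2) => /=; last by rewrite scalerDr.
  by split; [exact: bK|exact: bL].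
pose add (y : sigma_top X * sigma_top X) : sigma_top X := ((y.1 : Z) + (y.2 : Z)).
apply: (@continuous_compact _ _ add); last exact: compact_setX.
apply/continuous_subspaceT/sigma_continuous => x y.
rewrite [X in continuous_at _ X](_ : _ = fun y : sigma_top X * sigma_top X =>
    (subsp_val x y.1 : R) + subsp_val x y.2); last first.
  by apply/funext => w; rewrite /add linearD.
apply: cvgD.
  apply: (@continuous_comp _ _ _ fst (fun y : sigma_top X => subsp_val x y : R)).
    exact: cvg_fst.
  exact: sigma_eval_continuous.
apply: (@continuous_comp _ _ _ snd (fun y : sigma_top X => subsp_val x y : R)).
  exact: cvg_snd.
exact: sigma_eval_continuous.
Qed.

Lemma abs_convex_sigma_compact_segment (z : Z) :
  abs_convex_sigma_compact X [set t *: z | t in `[-1, 1]%classic].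
Proof.
split.
  split.
    apply/convex_setE => _ _ t /andP[t0 t1] [a /= + <-] [b /= + <-].
    rewrite !in_itv /= => /andP[a0 a1] /andP[b0 b1].
    exists (t * a + (1 - t) * b); last by rewrite !scalerA scalerDl.
    rewrite /= in_itv /=; apply/andP; split; nra.
  move=> a _ a1 [b /= + <-]; rewrite in_itv /= -ler_norml => b1.
  exists (a * b); last by rewrite scalerA.
  by rewrite /= in_itv /= -ler_norml normrM mulr_ile1.
apply: (@continuous_compact R (sigma_top X) (fun t : R => t *: z)); last first.
  exact: segment_compact.
apply/continuous_subspaceT/sigma_continuous => x t.
rewrite [X in continuous_at _ X](_ : _ = fun t : R => t * subsp_val x z); last first.
  by apply/funext => s; rewrite linearZ.
by apply: cvgMl; exact: cvg_id.
Qed.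

End DualPairTopology.

(** * Norming subspaces and Mackey completeness *)

Section NormingSubspace.
Context {R : realType} (Z : normedModType R) (X : submodClosed (dual Z)).

(** The points of [K] are continuous functionals on the Banach space [X],
    pointwise bounded by compactness; uniform boundedness bounds them on the
    unit ball of [X], and a norming [X] turns this into a bound in [Z]. *)
Lemma sigma_compact_bounded (K : set Z) :
  closed [set x : dual Z | x \in X] -> norming X ->
  compact (K : set (sigma_top X)) ->
  exists2 M : R, 0 <= M & forall z, K z -> `|z| <= M.
Proof.
move=> X_closed [_ [c [C [c0 C0 cC]]]] cK.
pose W : completeNormedModType R := HB.pack (subsp X)
  (Uniform_isComplete.Build (subsp X) (@subsp_cauchy_cvg _ _ _ X_closed)).
pose F : set (W -> R^o) := [set (fun x : subsp X => subsp_val x z) | z in K].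
have F_linear f : F f -> bounded_fun_norm f /\ linear f.
  move=> [z Kz <-]; split; last exact: (subsp_eval_linear z).
  move=> r; exists (r * `|z|) => x xr.
  by apply: (le_trans (dual_bound (subsp_val x) z)); rewrite ler_wpM2r.
have F_ptws : pointwise_bounded F.
  move=> x; have cx : compact ((fun z : sigma_top X => subsp_val (x : subsp X) z : R) @` K).
    by apply: continuous_compact cK; apply/continuous_subspaceT/sigma_eval_continuous.
  have [M [Mr KM]] := compact_bounded cx.
  exists (M + 1) => _ [z Kz <-]; apply: (KM (M + 1)); last by exists z.
  by rewrite ltrDl.
have [M FM] := Banach_Steinhauss F_linear F_ptws 1.
exists (`|M| / c) => [|z Kz]; first by rewrite divr_ge0// ltW.
rewrite ler_pdivlMr// mulrC (le_trans (andP (cC z)).1)//.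
apply: ge_sup.
  by exists 0, 0 => //=; rewrite normr0 ler01; split=> //; exact: rpred0.
move=> _ [x [/= xX x1] <-]; apply: (le_trans (ler_norm _)).
apply: (le_trans _ (ler_norm M)).
have Fz : F (fun x : subsp X => subsp_val x z) by exists z.
exact: (FM _ Fz (Subsp xX)).
Qed.

(** The easy half of Grothendieck's completeness theorem: the sets of
    approximants of [phi] form the basis of a Mackey-Cauchy filter on [X], and
    the limit of that filter agrees with [phi] at each point because segments
    are sigma(Z,X)-compact. *)
Lemma mackey_complete_mem (phi : dual Z) :
  complete_uniform (mackey X) ->
  (forall K (e : R), abs_convex_sigma_compact X K -> 0 < e ->
    exists x : subsp X, forall z, K z -> `|phi z - subsp_val x z| <= e) ->
  phi \in X.
Proof.
move=> X_complete phiK.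
pose ix : set (set Z * R) :=
  [set Ke | [/\ abs_convex_sigma_compact X Ke.1, Ke.1 0 & 0 < Ke.2]].
pose approx (Ke : set Z * R) : set (subsp X) :=
  [set x : subsp X | forall z, Ke.1 z -> `|phi z - subsp_val x z| <= Ke.2].
pose F := filter_from ix approx.
have segK z := abs_convex_sigma_compact_segment X z.
have seg (z : Z) : [set t *: z | t in `[-1 : R, 1]%classic] z.
  by exists 1; rewrite ?scale1r//= in_itv /= lexx andbT; lra.
have seg0 (z : Z) : [set t *: z | t in `[-1 : R, 1]%classic] 0.
  by apply: abs_convex0 (seg z); case: (segK z).
have FF : ProperFilter F.
  apply: filter_from_proper; last first.
    by move=> [K e] [/= KK _ e0]; exact: phiK.
  apply: filter_from_filter.
    exists ([set t *: (0 : Z) | t in `[-1 : R, 1]%classic], 1).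
    by split; [exact: segK|exact: seg0|exact: ltr01].
  move=> [K e] [L e'] [/= KK K0 e0] [/= LL L0 e'0].
  exists ([set y.1 + y.2 | y in K `*` L], Num.min e e').
    split => /=; first exact: abs_convex_sigma_compactD.
      by exists (0, 0) => //=; rewrite addr0.
    by rewrite lt_min e0.
  move=> x /= xKL; split=> z /= Kz.
    have /xKL : [set y.1 + y.2 | y in K `*` L] z by exists (z, 0) => //=; rewrite addr0.
    by rewrite le_min => /andP[].
  have /xKL : [set y.1 + y.2 | y in K `*` L] z by exists (0, z) => //=; rewrite add0r.
  by rewrite le_min => /andP[].
pose G := (fun x : subsp X => subsp_val x : Z -> R) @ F.
have Gphi : {family abs_convex_sigma_compact X, G --> (phi : Z -> R)}.
  apply/fam_cvgP => K KK P /uniform_nbhs [E [+ EP]].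
  rewrite -entourage_ballE => -[e /= e0 eE].
  have [K0|/set0P[z0 Kz0]] := eqVneq K set0.
    by apply: filterS (filterT : G setT) => f _; apply: EP => y; rewrite K0.
  exists (K, e / 2).
    by split => //=; [exact: abs_convex0 KK.1 Kz0|rewrite divr_gt0].
  move=> x /= xK; apply: EP => z Kz; apply: eE; rewrite -ball_normE /=.
  by rewrite (le_lt_trans (xK z Kz))// ltr_pdivrMr// ltr_pMr// ltr1n.
have G_cauchy : cauchy (G : set_system {family abs_convex_sigma_compact X, Z -> R}).
  exact: (@cvg_to_cauchy {family abs_convex_sigma_compact X, Z -> R} G (phi : Z -> R) _ Gphi).
have F_cauchy : cauchy (F : set_system (mackey X)).
  move=> A [E /= entE EA]; have [[P Q] /= [GP GQ] PQ] := G_cauchy E entE.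
  exists ((fun x : subsp X => subsp_val x : Z -> R) @^-1` P,
          (fun x : subsp X => subsp_val x : Z -> R) @^-1` Q) => //=.
  by move=> [x y] [/= Px Qy]; apply: EA; exact: (PQ (_, _)).
have [x0 Fx0] := X_complete F FF F_cauchy.
suff -> : phi = subsp_val x0 by case: x0 {Fx0}.
apply/val_inj/funext => z; apply/eqP; rewrite -subr_eq0 -normr_le0.
apply/ler_addgt0Pl => e e0; rewrite addr0 [e]splitr.
have e2 : 0 < e / 2 by rewrite divr_gt0.
pose K := [set t *: z | t in `[-1 : R, 1]%classic].
have Fphi : F (approx (K, e / 2)).
  by exists (K, e / 2) => //; split; [exact: segK|exact: seg0|].
have Fx : F [set x : subsp X | `|subsp_val x0 z - subsp_val x z| < e / 2].
  apply: (Fx0 [set x : subsp X | `|subsp_val x0 z - subsp_val x z| < e / 2]).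
  have := @initial_continuous (subsp X) {family abs_convex_sigma_compact X, Z -> R}
    (fun x : subsp X => subsp_val x : Z -> R) x0.
  have eE : entourage [set p : R * R | `|p.1 - p.2| < e / 2].
    by rewrite -entourage_ballE; exists (e / 2) => // p; rewrite -ball_normE.
  move/(_ _ (fam_nbhs ((subsp_val x0 : Z -> R) : {family abs_convex_sigma_compact X, Z -> R}) eE (segK z))).
  move=> near_x0; apply: (@filterS _ (nbhs (x0 : mackey X)) _ _ _ _ near_x0).
  by move=> x /(_ z (seg z)).
have [x [/= xphi xx0]] := filter_ex (filterI Fphi Fx).
rewrite -(subrKA (subsp_val x z)) (le_trans (ler_normD _ _))// lerD//.
  by apply: xphi; exact: seg.
by rewrite distrC ltW.
Qed.

End NormingSubspace.

(** * Minimisation and a strictly convex function of linear growth *)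

Section NearMinimizers.
Context {R : realType}.

(** [D] is the supremum over [i] of the infimum of [Phi] over [C i]: along a
    shrinking family it plays the role of the limit of the infima, so a late
    [C i] pins the values of its almost minimisers near [D] from both sides. *)
Lemma near_minimizers (I E : Type) (i0 : I) (C : I -> set E) (Phi : E -> R) (L : R) :
  (forall i, C i !=set0) -> (forall i z, C i z -> 0 <= Phi z <= L) ->
  exists D : R,
    (forall e, 0 < e -> exists i, forall z, C i z -> D - e <= Phi z) /\
    (forall e i, 0 < e -> exists2 z, C i z & Phi z <= D + e).
Proof.
move=> C0 PhiL; pose S := [set r | exists i, forall z, C i z -> r <= Phi z].
have S_sup : has_sup S.
  split; first by exists 0, i0 => z /PhiL/andP[].
  exists L => r [i ri]; have [z Cz] := C0 i.
  by rewrite (le_trans (ri z Cz))//; case/andP: (PhiL i z Cz).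
exists (sup S); split=> [e e0|e i e0].
  have [r [i ri] er] := sup_adherent e0 S_sup.
  by exists i => z /ri; apply: le_trans; exact: ltW.
apply: contrapT => /forall2NP noz.
suff : S (sup S + e) by move/(sup_upper_bound S_sup); rewrite gerDl leNgt e0.
by exists i => z Cz; have [//|/negP] := noz z; rewrite -ltNge => /ltW.
Qed.

End NearMinimizers.

Section StrictConvexity.
Context {R : realType}.
Implicit Types a b : R.

(** The length of the plane vector [(1, a)]: a strictly convex function of [a]
    with linear growth, hence integrable along every integrable function. *)
Definition arclen a : R := Num.sqrt (1 + a ^+ 2).

(** The second coordinate of the unit vector along [(1, a)].  It is a bounded
    increasing coordinate on the line, so closeness of [direction a] and
    [direction b] makes sense uniformly, also for very large [a] and [b]. *)
Definition direction a : R := a / arclen a.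

Lemma arclen_sqr a : arclen a ^+ 2 = 1 + a ^+ 2.
Proof. by rewrite sqr_sqrtr// addr_ge0// sqr_ge0. Qed.

Lemma arclen_ge1 a : 1 <= arclen a.
Proof. by rewrite -{1}sqrtr1 ler_wsqrtr// lerDl sqr_ge0. Qed.

Lemma arclen_gt0 a : 0 < arclen a.
Proof. exact: lt_le_trans ltr01 (arclen_ge1 a). Qed.

Lemma arclen_ge0 a : 0 <= arclen a.
Proof. exact/ltW/arclen_gt0. Qed.

Lemma arclen_le a : arclen a <= 1 + `|a|.
Proof.
rewrite -(@ler_pXn2r _ 2%N)// ?nnegrE ?addr_ge0 ?arclen_ge0//.
rewrite arclen_sqr sqrrD expr1n mul1r real_normK ?num_real//.
by have := normr_ge0 a; lra.
Qed.

Lemma direction_lt : {mono direction : a b / a < b}.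
Proof.
apply: leW_mono; apply: le_mono => a b ab; rewrite /direction.
rewrite ltr_pdivrMr ?arclen_gt0// mulrAC ltr_pdivlMr ?arclen_gt0//.
have := arclen_sqr a; have := arclen_sqr b.
have := arclen_gt0 a; have := arclen_gt0 b.
move: (arclen a) (arclen b) => s r r0 s0 r2 s2.
have [b0|b0] := leP b 0.
  suff : (- b) * s < (- a) * r by rewrite !mulNr ltrN2.
  rewrite -(@ltr_pXn2r _ 2%N)// ?nnegrE; [|nra|nra].
  by rewrite !exprMn s2 r2; nra.
have [a0|a0] := leP a 0; first nra.
rewrite -(@ltr_pXn2r _ 2%N)// ?nnegrE; [|nra|nra].
by rewrite !exprMn s2 r2; nra.
Qed.

Lemma direction_norm_le1 a : `|direction a| <= 1.
Proof.
rewrite normrM normfV (gtr0_norm (arclen_gt0 a)) ler_pdivrMr ?arclen_gt0// mul1r.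
rewrite -(@ler_pXn2r _ 2%N)// ?nnegrE ?arclen_ge0//.
by rewrite arclen_sqr real_normK ?num_real// lerDr.
Qed.

(** The triangle inequality for [u = (1, a)] and [v = (1, b)] is strict in terms
    of the distance [Q ^ (1 / 2)] of the unit vectors:
    [(|u| + |v|) ^ 2 - |u + v| ^ 2 = |u| |v| Q], and [|u|, |v| >= 1] makes
    [|u| |v| / (|u| + |v|) >= 1 / 2]. *)
Lemma arclen_gap a b :
  (direction a - direction b) ^+ 2 <=
  4 * (arclen a + arclen b - 2 * arclen ((a + b) / 2)).
Proof.
have := arclen_sqr a; have := arclen_sqr b; have := arclen_sqr ((a + b) / 2).
have := arclen_ge1 a; have := arclen_ge1 b; have := arclen_gt0 ((a + b) / 2).
rewrite /direction.
move: (arclen a) (arclen b) (arclen _) => s r m m0 r1 s1 m2 r2 s2.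
have s0 : s != 0 by apply: lt0r_neq0; lra.
have r0 : r != 0 by apply: lt0r_neq0; lra.
pose Q := (1 / s - 1 / r) ^+ 2 + (a / s - b / r) ^+ 2.
apply: (@le_trans _ _ Q); first by rewrite lerDr sqr_ge0.
have Q0 : 0 <= Q by rewrite addr_ge0// sqr_ge0.
have QE : s * r * Q = (s + r) ^+ 2 - (2 * m) ^+ 2.
  have -> : (2 * m) ^+ 2 = 4 + (a + b) ^+ 2.
    by rewrite exprMn m2; field.
  have -> : s * r * Q = (s * r * Q * (s * r)) / (s * r) by field; rewrite s0 r0.
  have -> : s * r * Q * (s * r) = (1 + a ^+ 2) * r ^+ 2 + (1 + b ^+ 2) * s ^+ 2 - 2 * (1 + a * b) * s * r.
    by rewrite /Q; field; rewrite s0 r0.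
  have -> : (s + r) ^+ 2 - (4 + (a + b) ^+ 2) = 2 * s * r - 2 * (1 + a * b).
    have -> : (s + r) ^+ 2 = s ^+ 2 + r ^+ 2 + 2 * s * r by ring.
    by rewrite s2 r2; ring.
  rewrite -s2 -r2.
  by field; rewrite s0 r0.
have mle : 2 * m <= s + r.
  rewrite -(@ler_pXn2r _ 2%N)// ?nnegrE; [|lra|lra].
  by rewrite -subr_ge0 -QE !mulr_ge0//; lra.
rewrite leNgt; apply/negP => lt.
have : (s + r - 2 * m) * (s + r + 2 * m) < s * r * Q; last by rewrite QE; nra.
apply: (@le_lt_trans _ _ ((s + r - 2 * m) * (2 * (s + r)))).
  by apply: ler_wpM2l; lra.
apply: (@lt_le_trans _ _ (Q / 4 * (2 * (s + r)))).
  by rewrite ltr_pM2r; lra.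
have : 0 <= Q * (2 * (s * r) - (s + r)) by rewrite mulr_ge0//; nra.
lra.
Qed.

End StrictConvexity.

(** * Separation from a finite-dimensional subspace of X *)

Section FiniteSeparation.
Context {R : realType} (Z : normedModType R) (X : submodClosed (dual Z)).

Lemma subsp_sumE (s : seq (subsp X)) (F : subsp X -> subsp X) z :
  subsp_val (\sum_(x <- s) F x) z = \sum_(x <- s) (subsp_val (F x) z : R).
Proof.
elim: s => [|x s IHs]; first by rewrite !big_nil.
rewrite !big_cons -IHs.
have -> : subsp_val (F x + \sum_(j <- s) F j) =
    subsp_val (F x) + subsp_val (\sum_(j <- s) F j) by [].
by rewrite dual_addE.
Qed.

Let form (s : seq (subsp X)) (y z : Z) : R :=
  \sum_(x <- s) subsp_val x y * subsp_val x z.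

Let form_ge0 s (z : Z) : 0 <= form s z z.
Proof. by apply: sumr_ge0 => x _; rewrite -expr2 sqr_ge0. Qed.

Let form_ge1 s (x : subsp X) (z : Z) : x \in s -> 1 < `|subsp_val x z| -> 1 <= form s z z.
Proof.
elim: s => // y s IHs; rewrite inE => /orP[/eqP <-|xs] x1; rewrite /form big_cons.
  rewrite -[leLHS]addr0 lerD ?form_ge0//.
  by rewrite -expr2 -real_normK ?num_real// expr2; nra.
by rewrite -[leLHS]add0r lerD ?IHs// -expr2 sqr_ge0.
Qed.

Let form_bounded s (M : R) : 0 <= M ->
  exists2 C : R, 0 <= C & forall z : Z, `|z| <= M -> form s z z <= C.
Proof.
move=> M0; exists (\sum_(x <- s) (`|subsp_val x| * M) ^+ 2).
  by apply: sumr_ge0 => x _; rewrite sqr_ge0.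
move=> z zM; apply: ler_sum => x _.
rewrite -expr2 -real_normK ?num_real// lerXn2r ?nnegrE ?mulr_ge0//.
by rewrite (le_trans (dual_bound _ _))// ler_wpM2l.
Qed.

Let form_line s y w (t : R) :
  form s (y + t *: w) (y + t *: w) =
  form s y y + 2 * t * form s y w + t ^+ 2 * form s w w.
Proof.
rewrite /form !mulr_sumr -!big_split /=; apply: eq_bigr => x _.
by rewrite !linearD !linearZ /=; rewrite [_ *: _]mulrC; ring.
Qed.

Let formBr s y z w : form s y (z - w) = form s y z - form s y w.
Proof.
rewrite /form -sumrB; apply: eq_bigr => x _.
by rewrite linearB /= mulrBr.
Qed.

(** Minimise [q z = eta ^ 2 * sum_x (x z) ^ 2 + (phi z - 2 eta) ^ 2] on [K].
    The hypothesis on [s] forces [q >= eta ^ 2].  The first order condition at an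
    almost minimiser [z0] is a linear inequality on [K] which, divided by
    [tau = 2 eta - phi z0], bounds [phi] minus a combination of the elements of
    [s] by [2 eta]; the coefficients are proportional to the values [x z0]. *)
Lemma finite_separation (K : set Z) (M : R) (phi : dual Z) (s : seq (subsp X)) (eta : R) :
  absolutely_convex K -> K 0 -> 0 <= M -> (forall z, K z -> `|z| <= M) -> 0 < eta ->
  (forall z, K z -> {in s, forall x : subsp X, `|subsp_val x z| <= 1} -> phi z < eta) ->
  exists x : subsp X, forall z, K z -> `|phi z - subsp_val x z| <= 2 * eta.
Proof.
move=> cK K0 M0 KM eta0 sphi; pose t := 2 * eta.
pose q z := eta ^+ 2 * form s z z + (phi z - t) ^+ 2.
have q_ge z : K z -> eta ^+ 2 <= q z.
  move=> Kz; have f0 := form_ge0 s z; have t0 := sqr_ge0 (phi z - t).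
  have [sz|] := pselect {in s, forall x : subsp X, `|subsp_val x z| <= 1}.
    have := sphi z Kz sz; rewrite /q /t in t0 * => pz.
    have : 0 <= eta ^+ 2 * form s z z by rewrite mulr_ge0// sqr_ge0.
    nra.
  move=> /existsNP[x /not_implyP[xs /negP]]; rewrite -ltNge => x1.
  by rewrite /q -[leLHS]addr0 lerD// ler_pMr ?exprn_gt0// (form_ge1 xs x1).
have [C C0 formC] := form_bounded s (mulr_ge0 (ler0n _ 2) M0).
pose P := eta ^+ 2 * C + (`|phi| * (2 * M)) ^+ 2.
have P0 : 0 <= P by apply: addr_ge0; [apply: mulr_ge0 => //; exact: sqr_ge0|exact: sqr_ge0].
(* The step along the segment from z0 to z; the second-order term r ^ 2 * P and
   the error r ^ 2 of the almost minimiser must be small compared to r. *)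
pose r := Num.min 1 (eta ^+ 2 / (P + 1)).
have eta20 : 0 < eta ^+ 2 by rewrite exprn_gt0.
have r0 : 0 < r by rewrite lt_min ltr01 divr_gt0// ltr_wpDl.
have r1 : r <= 1 by rewrite ge_min lexx.
have rP : r * (P + 1) <= eta ^+ 2.
  by rewrite -ler_pdivlMr ?ltr_wpDl// ge_min lexx orbT.
have q_inf : has_inf [set q z | z in K].
  split; first by exists (q 0), 0.
  by exists 0 => _ [z Kz <-]; rewrite (le_trans _ (q_ge z Kz))// ltW.
have r20 : 0 < r ^+ 2 by rewrite exprn_gt0.
have [_ [z0 Kz0 <-] z0r] := inf_adherent r20 q_inf.
have q_z0 z : K z -> q z0 <= q z + r ^+ 2.
  move=> Kz; apply: (le_trans (ltW z0r)); rewrite lerD2r.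
  by apply: ge_inf; [exact: q_inf.2|exists z].
pose B z := eta ^+ 2 * form s z0 z + (phi z0 - t) * phi z.
have variation z : K z -> B z0 - eta ^+ 2 / 2 <= B z.
  move=> Kz; pose w := z - z0.
  have wM : `|w| <= 2 * M.
    by rewrite (le_trans (ler_normB _ _))//; have := KM z Kz; have := KM z0 Kz0; lra.
  have Kr : K (z0 + r *: w).
    have -> : z0 + r *: w = r *: z + (1 - r) *: z0.
      by rewrite /w scalerBr scalerBl scale1r addrCA addrA.
    by apply: (convex_setE K).1 => //; [exact: cK.1|rewrite ltW].
  have phir : phi (z0 + r *: w) = phi z0 + r * phi w by rewrite linearD linearZ.
  have := q_z0 _ Kr; rewrite /q form_line phir.
  have phiw : phi w = phi z - phi z0 by rewrite /w linearB.
  have formw : form s z0 w = form s z0 z - form s z0 z0 by rewrite /w formBr.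
  have qw : eta ^+ 2 * form s w w + (phi w) ^+ 2 <= P.
    apply: lerD; first by apply: ler_wpM2l; [exact: ltW|exact: formC].
    rewrite -real_normK ?num_real// lerXn2r ?nnegrE ?mulr_ge0//.
    by apply: (le_trans (dual_bound _ _)); apply: ler_wpM2l.
  move=> q_r.
  have : 0 <= r * (2 * (B z - B z0) + r * (P + 1)).
    have : 0 <= r ^+ 2 * (P - (eta ^+ 2 * form s w w + (phi w) ^+ 2)).
      by rewrite mulr_ge0 ?subr_ge0// ltW.
    rewrite /B; move: q_r; rewrite formw !phiw; nra.
  by rewrite pmulr_rge0//; lra.
pose tau := t - phi z0.
have Bz0 : B z0 = q z0 - t * tau by rewrite /B /q /tau; ring.
have Btau z : B z = eta ^+ 2 * form s z0 z - tau * phi z by rewrite /B /tau; ring.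
have tau_ge z : K z -> tau * phi z - eta ^+ 2 * form s z0 z < t * tau.
  move=> Kz; have := variation z Kz; have := q_ge _ Kz0.
  by rewrite Bz0 Btau; lra.
have tau0 : 0 < tau.
  have := tau_ge 0 K0; rewrite linear0 mulr0 sub0r.
  have -> : form s z0 0 = 0.
    by rewrite /form big1// => x _; rewrite linear0 mulr0.
  by rewrite mulr0 oppr0 pmulr_rgt0// mulr_gt0.
pose x := (eta ^+ 2 / tau) *: \sum_(x <- s) (subsp_val x z0 : R) *: x.
have xE z : subsp_val x z = eta ^+ 2 / tau * form s z0 z.
  rewrite /x; apply: (etrans (subsp_scaleE _ _ _)); congr (_ * _).
  apply: (etrans (subsp_sumE _ _ _)); apply: eq_bigr => y _.
  exact: subsp_scaleE.
have upper z : K z -> phi z - subsp_val x z <= t.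
  move=> Kz; rewrite xE -(ler_pM2l tau0) mulrBr mulrA mulrCA mulfV ?mulr1 ?gt_eqF//.
  by rewrite [leRHS]mulrC ltW// tau_ge.
exists x => z Kz; rewrite ler_norml upper// andbT.
have := upper _ (abs_convexN cK Kz); rewrite !linearN/=.
by rewrite opprK addrC -opprB lerNl.
Qed.

End FiniteSeparation.

(** * Densities of real set functions *)

Section Density.
Context {R : realType} {d : measure_display} {Omega : measurableType d}.
Variable mu : {finite_measure set Omega -> \bar R}.
Implicit Types (lam : set Omega -> R) (f g h : Omega -> R) (A B : set Omega).

(** Densities are relative to real set functions because they are applied to
    [fun A => nu A z] for a fixed [z]. *)
Definition is_density lam f :=
  [/\ measurable_fun setT f, mu.-integrable setT (EFin \o f) &
      forall A, measurable A -> lam A = \int[mu]_(x in A) f x].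

Lemma integrable_sub A f : measurable A ->
  mu.-integrable setT (EFin \o f) -> mu.-integrable A (EFin \o f).
Proof. by move=> mA; apply: integrableS. Qed.

Lemma integrable_addR f g : mu.-integrable setT (EFin \o f) ->
  mu.-integrable setT (EFin \o g) ->
  mu.-integrable setT (EFin \o (fun x => f x + g x)).
Proof.
move=> If Ig.
have -> : EFin \o (fun x => f x + g x) = ((EFin \o f) \+ (EFin \o g))%E by [].
exact: integrableD.
Qed.

Lemma integrable_scaleR (k : R) f : mu.-integrable setT (EFin \o f) ->
  mu.-integrable setT (EFin \o (fun x => k * f x)).
Proof.
move=> If; have -> : EFin \o (fun x => k * f x) = (fun x => k%:E * (EFin \o f) x)%E.
  by [].
exact: integrableZl.
Qed.

Lemma integrable_subR f g : mu.-integrable setT (EFin \o f) ->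
  mu.-integrable setT (EFin \o g) ->
  mu.-integrable setT (EFin \o (fun x => f x - g x)).
Proof.
move=> If Ig.
have -> : EFin \o (fun x => f x - g x) = ((EFin \o f) \- (EFin \o g))%E by [].
exact: integrableB.
Qed.

Lemma integrable_bounded f (M : R) : measurable_fun setT f ->
  (forall x, `|f x| <= M) -> mu.-integrable setT (EFin \o f).
Proof.
move=> mf fM; apply: measurable_bounded_integrable => //.
  by rewrite -ge0_fin_numE// fin_num_measure.
exists M; split; first exact: num_real.
by move=> r Mr x _; exact: le_trans (fM x) (ltW Mr).
Qed.

Lemma measurable_lt f g : measurable_fun setT f -> measurable_fun setT g ->
  measurable [set x | f x < g x].
Proof.
move=> mf mg; have := measurable_fun_ltr mf mg measurableT (Y := [set true]) I.
by rewrite setTI; congr measurable; apply/seteqP; split => x /=.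
Qed.

Lemma Rintegral_subset_le A f : measurable A ->
  mu.-integrable setT (EFin \o f) -> (forall x, 0 <= f x) ->
  \int[mu]_(x in A) f x <= \int[mu]_x f x.
Proof.
move=> mA If f0; rewrite -(setUv A) Rintegral_setU ?lerDl ?Rintegral_ge0//.
- exact: measurableC.
- by rewrite setUv.
- by apply/disj_setPS => x [].
Qed.

Lemma density_ge lam f A (c : R) : is_density lam f -> measurable A ->
  (forall x, A x -> c <= f x) -> c * fine (mu A) <= lam A.
Proof.
move=> [mf If lamE] mA cf; rewrite lamE// -Rintegral_cst//.
apply: le_Rintegral => //; last exact: integrable_sub.
exact: finite_measure_integrable_cst.
Qed.

Lemma density_le lam f A (c : R) : is_density lam f -> measurable A ->
  (forall x, A x -> f x <= c) -> lam A <= c * fine (mu A).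
Proof.
move=> [mf If lamE] mA cf; rewrite lamE// -Rintegral_cst//.
apply: le_Rintegral => //; first exact: integrable_sub.
exact: finite_measure_integrable_cst.
Qed.

Lemma density_split lam f A B : is_density lam f -> measurable A -> measurable B ->
  lam A = lam (A `&` B) + lam (A `\` B).
Proof.
move=> [mf If lamE] mA mB.
have mI := measurableI A B mA mB; have mD := measurableD mA mB.
rewrite !lamE// -Rintegral_setU//; last 2 first.
- by apply: integrable_sub => //; exact: measurableU.
- by apply/disj_setPS => x [[_ Bx] [_ /(_ Bx)]].
by rewrite setUIDK.
Qed.

Lemma density_null lam f A : is_density lam f -> measurable A -> mu A = 0%E ->
  lam A = 0.
Proof.
move=> [mf If lamE] mA muA0; rewrite lamE// /Rintegral.
by rewrite null_set_integral//; exact: measurable_int (integrable_sub mA If).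
Qed.

(** The part of [A] where [f] is below [c] is null and contributes nothing. *)
Lemma density_ge_ae lam f A (c : R) :
  is_density lam f -> measurable A -> mu (A `&` [set x | f x < c]) = 0%E ->
  c * fine (mu A) <= lam A.
Proof.
move=> lamf mA A0; have [mf _ _] := lamf.
have mG : measurable [set x | f x < c] by exact: measurable_lt.
have mAG := measurableD mA mG.
rewrite (density_split lamf mA mG) (density_null lamf _ A0)//; last exact: measurableI.
rewrite add0r (_ : mu A = mu (A `\` [set x | f x < c])); first by apply: (density_ge lamf) => // x [_ /= /negP]; rewrite -leNgt.
by rewrite [LHS](measureDI mu mA mG) -[RHS]adde0 -[in RHS]A0 addeC.
Qed.

Lemma density_norm lam f : is_density lam f ->
  \int[mu]_x `|f x| =
    lam (f @^-1` [set r | 0 <= r]) - lam (f @^-1` [set r | r < 0]).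
Proof.
move=> [mf If lamE].
have mP : measurable (f @^-1` [set r | 0 <= r]).
  by rewrite -[X in measurable X]setTI -set_itvcy; apply: mf => //; exact: measurable_itv.
have mN : measurable (f @^-1` [set r | r < 0]).
  by rewrite -[X in measurable X]setTI -set_itvNyo; apply: mf => //; exact: measurable_itv.
have PN : setT = f @^-1` [set r | 0 <= r] `|` f @^-1` [set r | r < 0].
  by apply/seteqP; split=> // x _; have [?|?] := leP 0 (f x); [left|right].
rewrite !lamE// PN Rintegral_setU//; last 2 first.
- by rewrite -PN; exact: integrable_norm.
- by apply/disj_setPS => x /= [f0]; rewrite ltNge f0.
congr (_ + _).
  by apply: eq_Rintegral => x /[!inE] /= f0; rewrite ger0_norm.
rewrite -mulN1r -RintegralZl//; last exact: integrable_sub.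
by apply: eq_Rintegral => x /[!inE] /= f0; rewrite mulN1r ltr0_norm.
Qed.

Lemma density_norm_le lam f A : is_density lam f -> measurable A ->
  `|lam A| <= \int[mu]_x `|f x|.
Proof.
move=> [mf If lamE] mA; rewrite lamE//.
apply: le_trans (le_normr_Rintegral mA (integrable_sub mA If)) _.
by apply: Rintegral_subset_le => //; exact: integrable_norm.
Qed.

(** Densities are chosen separately for each point, so linearity in the point
    holds only up to null sets, by uniqueness of densities. *)
Lemma density_midpoint lam1 lam2 f g h :
  is_density lam1 f -> is_density lam2 g ->
  is_density (fun A => (lam1 A + lam2 A) / 2) h ->
  \forall x \ae mu, h x = (f x + g x) / 2.
Proof.
move=> [mf If lam1E] [mg Ig lam2E] [mh Ih lamE].
have Ifg := integrable_addR If Ig.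
have Ifg2 : mu.-integrable setT (EFin \o (fun x => (f x + g x) / 2)).
  by under [X in _ \o X]eq_fun do rewrite mulrC; exact: integrable_scaleR.
have : ae_eq mu setT (EFin \o h) (EFin \o (fun x => (f x + g x) / 2)).
  apply: integral_ae_eq => //; first exact: measurable_int Ifg2.
  move=> A _ mA.
  have fin (k : Omega -> R) : mu.-integrable setT (EFin \o k) ->
      (\int[mu]_(x in A) (k x)%:E = (\int[mu]_(x in A) k x)%R%:E)%E.
    move=> Ik; rewrite /Rintegral fineK//; apply: integrable_fin_num => //.
    exact: integrable_sub Ik.
  rewrite !fin// -lamE// lam1E// lam2E//; congr EFin.
  rewrite -RintegralD//; [|exact: integrable_sub..].
  by rewrite -RintegralZr//; exact: integrable_sub.
by apply: filterS => x /(_ I) [].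
Qed.

End Density.

(** * The energy of a density *)

Section Energy.
Context {R : realType} {d : measure_display} {Omega : measurableType d}.
Variable mu : {finite_measure set Omega -> \bar R}.
Implicit Types (lam : set Omega -> R) (f g h : Omega -> R) (A B : set Omega).

(** The total variation of the plane-valued measure [(mu, f mu)]. *)
Definition energy f := \int[mu]_x arclen (f x).

Lemma measurable_arclen : measurable_fun setT (@arclen R).
Proof.
apply: continuous_measurable_fun => a; apply: continuous_comp; last exact: sqrt_continuous.
by apply: cvgD; [exact: cvg_cst|exact: exprn_continuous].
Qed.

Lemma measurable_direction : measurable_fun setT (@direction R).
Proof.
apply: continuous_measurable_fun => a; apply: cvgM; first exact: cvg_id.
apply: cvgV; first by rewrite gt_eqF ?arclen_gt0.
apply: continuous_comp; last exact: sqrt_continuous.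
by apply: cvgD; [exact: cvg_cst|exact: exprn_continuous].
Qed.

Lemma integrable_arclen f : measurable_fun setT f ->
  mu.-integrable setT (EFin \o f) -> mu.-integrable setT (EFin \o (fun x => arclen (f x))).
Proof.
move=> mf If.
have I1 : mu.-integrable setT (EFin \o (fun x => 1 + `|f x|)).
  apply: integrable_addR; first exact: (finite_measure_integrable_cst mu 1).
  exact: integrable_norm.
apply: le_integrable I1 => //.
  apply/measurable_EFinP; exact: measurableT_comp measurable_arclen mf.
move=> x _ /=; rewrite lee_fin (ger0_norm (arclen_ge0 _)).
exact: le_trans (arclen_le _) (ler_norm _).
Qed.

Lemma energy_bounds lam f (C : R) : is_density mu lam f ->
  (forall A, measurable A -> `|lam A| <= C) ->
  0 <= energy f <= fine (mu setT) + 2 * C.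
Proof.
move=> lamf lamC; have [mf If _] := lamf.
apply/andP; split; first by apply: Rintegral_ge0 => x _; exact: arclen_ge0.
have I1 := finite_measure_integrable_cst mu (1 : R) (@measurableT _ Omega).
have In : mu.-integrable setT (EFin \o (fun x => `|f x|)) by exact: integrable_norm.
apply: (@le_trans _ _ (\int[mu]_x (1 + `|f x|))).
  apply: le_Rintegral => //; first exact: integrable_arclen.
    exact: integrable_addR.
  by move=> x _; exact: arclen_le.
rewrite RintegralD// Rintegral_cst// mul1r lerD2l (density_norm lamf).
have mP : measurable (f @^-1` [set r | 0 <= r]).
  by rewrite -[X in measurable X]setTI -set_itvcy; apply: mf => //; exact: measurable_itv.
have mN : measurable (f @^-1` [set r | r < 0]).
  by rewrite -[X in measurable X]setTI -set_itvNyo; apply: mf => //; exact: measurable_itv.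
rewrite (le_trans (ler_norm _))// (le_trans (ler_normB _ _))//.
by rewrite mulr_natl mulr2n lerD ?lamC.
Qed.

Lemma measurable_direction_gap f g : measurable_fun setT f -> measurable_fun setT g ->
  measurable_fun setT (fun x => direction (f x) - direction (g x)).
Proof.
by move=> mf mg; apply: measurable_funB;
  apply: measurableT_comp measurable_direction _.
Qed.

Lemma direction_gap_norm f g x : `|direction (f x) - direction (g x)| <= 2.
Proof.
by rewrite (le_trans (ler_normB _ _))// (_ : 2 = 1 + 1) ?lerD ?direction_norm_le1//.
Qed.

(** The gap of [arclen] at midpoints, integrated: if [h] is the density of the
    midpoint, it cannot beat [D] by more than [e], and this forces the two
    almost minimisers [f] and [g] to be close in measure. *)
Lemma energy_gap lam1 lam2 f g h (D e : R) :
  is_density mu lam1 f -> is_density mu lam2 g ->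
  is_density mu (fun A => (lam1 A + lam2 A) / 2) h ->
  energy f <= D + e -> energy g <= D + e -> D - e <= energy h ->
  \int[mu]_x (direction (f x) - direction (g x)) ^+ 2 <= 16 * e.
Proof.
move=> lam1f lam2g lamh fD gD hD.
have [mf If _] := lam1f; have [mg Ig _] := lam2g; have [mh Ih _] := lamh.
have hE : energy h = \int[mu]_x arclen ((f x + g x) / 2).
  congr fine; apply: ae_eq_integral => //.
  - by apply/measurable_EFinP; exact: measurableT_comp measurable_arclen mh.
  - apply/measurable_EFinP; apply: measurableT_comp measurable_arclen _.
    by apply: measurable_funM => //; exact: measurable_funD.
  - by have := density_midpoint lam1f lam2g lamh; apply: filterS => x -> _.
have Iaf := integrable_arclen mf If; have Iag := integrable_arclen mg Ig.
have Iam : mu.-integrable setT (EFin \o (fun x => arclen ((f x + g x) / 2))).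
  apply: integrable_arclen.
    by apply: measurable_funM => //; exact: measurable_funD.
  under [X in _ \o X]eq_fun do rewrite mulrC.
  exact/integrable_scaleR/integrable_addR.
have I2 := integrable_scaleR 2 Iam.
have Ifg := integrable_addR Iaf Iag.
have I3 := integrable_subR Ifg I2.
apply: (@le_trans _ _ (\int[mu]_x (4 * (arclen (f x) + arclen (g x)
    - 2 * arclen ((f x + g x) / 2))))).
  apply: le_Rintegral => //.
  - apply: (@integrable_bounded _ _ _ _ _ 4).
      exact/measurable_funX/measurable_direction_gap.
    move=> x; rewrite normrX (_ : 4 = 2 ^+ 2); last by rewrite -natrX.
    by rewrite lerXn2r ?nnegrE// direction_gap_norm.
  - exact: integrable_scaleR.
  - by move=> x _; exact: arclen_gap.
rewrite RintegralZl// RintegralB// RintegralD// RintegralZl//.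
by move: fD gD hD; rewrite hE /energy; lra.
Qed.

(** By Chebyshev the set where [|h n| > 2 ^ - n] has measure at most
    [4 ^ n / 8 ^ n], which is summable. *)
Lemma borel_cantelli_L2 (h : nat -> Omega -> R) (M : R) :
  (forall n, measurable_fun setT (h n)) -> (forall n x, `|h n x| <= M) ->
  (forall n, \int[mu]_x (h n x) ^+ 2 <= (8 ^+ n)^-1) ->
  \forall x \ae mu, exists n0, forall n, (n0 <= n)%N -> `|h n x| <= (2 ^+ n)^-1.
Proof.
move=> mh hM h8; pose F n := [set x | (2 ^+ n)^-1 < `|h n x|].
have mF n : measurable (F n).
  by apply: measurable_lt => //; exact: measurableT_comp.
have Ih n : mu.-integrable setT (EFin \o (fun x => h n x ^+ 2)).
  apply: (@integrable_bounded _ _ _ _ _ (M ^+ 2)); first exact: measurable_funX.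
  move=> x; rewrite normrX lerXn2r ?nnegrE// (le_trans _ (hM n x))//.
have muF n : (mu (F n) <= (2 / (2 ^ (n + 1))%:R)%:E)%E.
  rewrite -[leLHS]fineK ?fin_num_measure// lee_fin.
  have cheb : (2 ^+ n)^-1 ^+ 2 * fine (mu (F n)) <= (8 ^+ n)^-1.
    apply: le_trans (h8 n); rewrite -Rintegral_cst//.
    apply: (@le_trans _ _ (\int[mu]_(x in F n) h n x ^+ 2)); last first.
      by apply: Rintegral_subset_le => // x; exact: sqr_ge0.
    apply: le_Rintegral => //; last first.
    - move=> x /ltW Fx; rewrite -[leRHS]real_normK ?num_real//.
      by rewrite lerXn2r ?nnegrE.
    - exact: integrable_sub.
    exact: finite_measure_integrable_cst.
  rewrite natrX addn1 exprS invfM mulrA divff// mul1r.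
  have p0 : 0 < 2 ^+ n :> R by rewrite exprn_gt0.
  have := ler_wpM2l (ltW (exprn_gt0 2 p0)) cheb.
  rewrite mulrA -exprMn divff ?gt_eqF// expr1n mul1r => /le_trans; apply.
  have -> : 8 ^+ n = 2 ^+ n * 2 ^+ n * 2 ^+ n :> R.
    by rewrite -!exprMn; congr (_ ^+ _); rewrite -!natrM.
  rewrite expr2.
  by rewrite le_eqVlt; apply/orP; left; apply/eqP; field; rewrite gt_eqF.
have F0 : mu (lim_sup_set F) = 0%E.
  apply: lim_sup_set_cvg0 => //.
  apply: (@le_lt_trans _ _ (\sum_(n <oo) (2 / (2 ^ (n + 1))%:R)%:E)%E).
    by apply: lee_nneseries => n // _; exact: muF.
  by rewrite (cvg_lim _ (@cvg_geometric_eseries_half R 2 0)) ?ltry.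
exists (lim_sup_set F); split => //.
  by apply: bigcap_measurable => // n _; exact: bigcup_measurable.
move=> x /= /forallNP hx n _.
have /existsNP[m /not_implyP[nm /negP]] := hx n.
by rewrite -ltNge => h2; exists m.
Qed.

End Energy.

(** * Scalar densities and average ranges of vector measures *)

Section EventualProperties.
Context {R : realType} {d : measure_display} {Omega : measurableType d}.
Variable mu : {finite_measure set Omega -> \bar R}.
Implicit Types A : set Omega.

(** If all [A `&` E n] were null, then [A] would be null, being covered by them
    up to a null set. *)
Lemma measure_eventually_gt0 (E : nat -> set Omega) A : measurable A ->
  (0 < mu A)%E -> (forall n, measurable (E n)) ->
  (\forall x \ae mu, A x -> exists n, E n x) -> exists n, (0 < mu (A `&` E n))%E.
Proof.
move=> mA muA mE AE; apply: contrapT => /forallNP E0.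
have : mu.-negligible A.
  have AEn n : mu.-negligible (A `&` E n).
    apply/negligibleP; first exact: measurableI.
    apply/eqP; rewrite eq_le measure_ge0 andbT leNgt; exact/negP/E0.
  apply: negligibleS (negligibleU AE (negligible_bigcup AEn)) => x Ax.
  have [[n Enx]|nE] := pselect (exists n, E n x); first by right; exists n.
  by left=> /(_ Ax).
by move=> /(measure_negligible mA) A0; rewrite A0 ltxx in muA.
Qed.

Lemma measure_eventually_small (E : nat -> set Omega) (e : R) : 0 < e ->
  (forall n, measurable (E n)) -> (forall n m, (n <= m)%N -> E n `<=` E m) ->
  (\forall x \ae mu, exists n, E n x) -> exists n, (mu (~` E n) < e%:E)%E.
Proof.
move=> e0 mE Emono aeE.
have mCE n : measurable (~` E n) by exact: measurableC.
have mI : measurable (\bigcap_n ~` E n) by exact: bigcap_measurable.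
have mu0 : mu (\bigcap_n ~` E n) = 0%E.
  apply: measure_negligible => //; apply: negligibleS aeE => x Ex [n Enx].
  exact: Ex n I Enx.
have CE_dec : nonincreasing_seq (fun n => ~` E n).
  by move=> n m nm; apply/subsetPset/subsetC/Emono.
have muC0 : (mu (~` E 0%N) < +oo)%E by rewrite ltey_eq fin_num_measure.
have : mu \o (fun n => ~` E n) @ \oo --> 0%E.
  by rewrite -mu0; exact: nonincreasing_cvg_mu.
move=> /fine_cvgP[_ /cvgrPdist_lt /(_ e e0)[N _ /(_ N (leqnn N))]] /=.
rewrite sub0r normrN ger0_norm ?fine_ge0// => muN; exists N.
by rewrite -[ltLHS]fineK ?lte_fin// fin_num_measure.
Qed.

End EventualProperties.

Section VectorMeasureDensity.
Context {R : realType} {d : measure_display} {Omega : measurableType d}.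
Variables (mu : {finite_measure set Omega -> \bar R}) (Z : completeNormedModType R).
Variable nu : set Omega -> dual Z.
Hypothesis nu_additive : countably_additive nu.
Hypothesis nu_continuous : measure_continuous mu nu.

Lemma measure_continuous_null A : measurable A -> mu A = 0%E -> nu A = 0.
Proof.
move=> mA muA0; apply/normr0_eq0/eqP; rewrite eq_le normr_ge0 andbT.
apply/ler_addgt0Pl => e e0; rewrite addr0; have [r r0] := nu_continuous e0.
by move=> /(_ _ mA); rewrite muA0 lte_fin => /(_ r0)/ltW.
Qed.

(** Evaluation at [z] is norm continuous on the dual, so [nu] followed by it is
    a charge, and mu-continuity makes it absolutely continuous. *)
Lemma density_exists (z : Z) : exists f, is_density mu (fun A => nu A z) f.
Proof.
pose lam A := (nu A z : R)%:E.
have lam0 : lam set0 = 0%E by rewrite /lam measure_continuous_null.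
have lam_fin A : measurable A -> lam A \is a fin_num by [].
have lam_sigma : semi_sigma_additive lam.
  move=> F mF tF _.
  have lamE n : (\sum_(0 <= i < n) lam (F i))%E = ((\sum_(0 <= i < n) nu (F i)) z : R)%:E.
    by rewrite sumEFin; congr EFin; elim/big_ind2: _ => // f r g s -> ->.
  apply: cvg_EFin; first by apply: nearW => n; rewrite lamE.
  rewrite (_ : _ \o _ = fun n => (\sum_(0 <= i < n) nu (F i)) z : R); last first.
    by apply/funext => n /=; rewrite lamE.
  apply: (@continuous_cvg _ _ _ _ _ _ (fun f : dual Z => f z : R)).
    exact: dual_eval_continuous.
  exact: nu_additive.
pose C : {charge set Omega -> \bar R} := HB.pack lam
  (isCharge.Build _ _ _ lam lam0 lam_fin lam_sigma).
have C_mu : C `<< mu.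
  apply/null_content_dominatesP => A mA muA0.
  by rewrite /= /lam measure_continuous_null.
have [If CE] := (Radon_Nikodym_integrable C_mu, @Radon_Nikodym_integral _ _ _ C mu).
have EFinE : EFin \o (fine \o Radon_Nikodym C mu) = Radon_Nikodym C mu.
  by apply/funext => x /=; rewrite fineK// Radon_Nikodym_fin_num.
exists (fine \o Radon_Nikodym C mu); split.
- apply/measurable_EFinP; rewrite EFinE; exact: measurable_int If.
- by rewrite EFinE.
- move=> A mA; rewrite /Rintegral.
  have := CE A C_mu mA; rewrite -EFinE => <- //.
Qed.

(** Pointwise on [Z] the values of [nu] are bounded by the L1 norm of a density;
    uniform boundedness does the rest.  A direct argument from mu-continuity
    would have to treat the atoms of [mu] separately. *)
Lemma measure_continuous_bounded :
  exists2 S : R, 0 <= S & forall A, measurable A -> `|nu A| <= S.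
Proof.
pose F : set (Z -> R^o) := [set (nu A : Z -> R^o) | A in measurable].
have F_linear f : F f -> bounded_fun_norm f /\ linear f.
  move=> [A mA <-]; split; last exact: dual_is_linear.
  move=> r; exists (`|nu A| * r) => z zr.
  by apply: (le_trans (dual_bound _ _)); rewrite ler_wpM2l.
have F_ptws : pointwise_bounded F.
  move=> z; have [f fz] := density_exists z.
  by exists (\int[mu]_x `|f x|) => _ [A mA <-]; exact: density_norm_le fz mA.
have [S FS] := Banach_Steinhauss F_linear F_ptws 1.
exists `|S| => // A mA; apply: dual_norm_le => z z1.
by apply: le_trans (ler_norm S); apply: FS => //; exists A.
Qed.

Lemma average_ge A (z : Z) (c : R) (x : dual Z) :
  (forall B, measurable B -> B `<=` A -> c * fine (mu B) <= nu B z) ->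
  closure (convex_hull (average_range mu nu A) : set (weak_star Z)) x -> c <= x z.
Proof.
move=> cB; apply: closure_convex_hull_ge => _ [B [mB BA muB] <-].
have muB0 : 0 < fine (mu B) by rewrite fine_gt0// muB ltey_eq fin_num_measure.
by rewrite dual_scaleE mulrC ler_pdivlMr// cB.
Qed.

Lemma average_le A (z : Z) (c : R) (x : dual Z) :
  (forall B, measurable B -> B `<=` A -> nu B z <= c * fine (mu B)) ->
  closure (convex_hull (average_range mu nu A) : set (weak_star Z)) x -> x z <= c.
Proof.
move=> cB; apply: closure_convex_hull_le => _ [B [mB BA muB] <-].
have muB0 : 0 < fine (mu B) by rewrite fine_gt0// muB ltey_eq fin_num_measure.
by rewrite dual_scaleE mulrC ler_pdivrMr// cB.
Qed.

End VectorMeasureDensity.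

(** * Uniform approximation on sigma-compact sets *)

Section RealSequences.
Context {R : realType}.

Lemma half_pow_small (e : R) : 0 < e -> exists n0, forall n, (n0 <= n)%N -> (2 ^+ n)^-1 < e.
Proof.
move=> e0; exists (Num.bound e^-1) => n nb.
rewrite -[e]invrK ltf_pV2 ?posrE ?exprn_gt0 ?invr_gt0//.
apply: (lt_trans (archi_boundP _)); first by rewrite invr_ge0 ltW.
by rewrite -natrX ltr_nat (leq_ltn_trans nb)// ltn_expl.
Qed.

(** The sequence converges: if its limit is larger than [a] the first case
    holds, otherwise the second one does. *)
Lemma geometric_dichotomy (u : nat -> R) (n0 : nat) (a b : R) :
  (forall n, (n0 <= n)%N -> `|u n - u n.+1| <= (2 ^+ n)^-1) -> a < b ->
  (exists n, forall m, (n <= m)%N -> a < u m) \/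
  (exists n, forall m, (n <= m)%N -> u m <= b).
Proof.
move=> u2 ab; apply: contrapT => /not_orP[/forallNP ua /forallNP ub].
have ab2 : 0 < (b - a) / 2 by rewrite divr_gt0// subr_gt0.
have [n1 n1ab] := half_pow_small ab2.
have /existsNP[m /not_implyP[nm /negP]] := ua (maxn n0 n1); rewrite -leNgt => uma.
move: nm; rewrite geq_max => /andP[n0m n1m].
have umk k : u (m + k)%N <= a + 2 * (2 ^+ m)^-1 - 2 * (2 ^+ (m + k))^-1.
  elim: k => [|k IHk]; first by rewrite addn0 addrK.
  have := u2 (m + k)%N (leq_trans n0m (leq_addr _ _)).
  rewrite ler_distl addnS => /andP[ukS _].
  by rewrite exprS invfM mulrA divff// mul1r; move: IHk ukS; lra.
apply: (ub m) => k mk; rewrite -(subnKC mk).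
apply: (le_trans (umk _)).
have := n1ab m n1m.
have : 0 <= (2 ^+ (m + (k - m)))^-1 :> R by rewrite invr_ge0 exprn_ge0.
lra.
Qed.

End RealSequences.

Section CompactApproximation.
Context {R : realType} {d : measure_display} {Omega : measurableType d}.
Variables (mu : {finite_measure set Omega -> \bar R}) (Z : completeNormedModType R).
Variable X : submodClosed (dual Z).
Hypothesis X_closed : closed [set x : dual Z | x \in X].
Hypothesis X_norming : norming X.
Variable nu : set Omega -> dual Z.
Hypothesis nu_additive : countably_additive nu.
Hypothesis nu_continuous : measure_continuous mu nu.
Hypothesis nu_average : forall A : set Omega, measurable A -> (0 < mu A)%E ->
  closure (convex_hull (average_range mu nu A) : set (weak_star Z))
    `&` [set x : dual Z | x \in X] !=set0.

(** On a set with complement of small measure all late densities are at most [c]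
    and contribute at most [c * mu setT]; the rest of the integral is small
    uniformly over the bounded sequence [z], as [nu] is mu-continuous in norm. *)
Lemma eventually_small_value (A0 : set Omega) (f : nat -> Omega -> R) (z : nat -> Z)
    (M eta c : R) :
  measurable A0 -> 0 < eta -> 0 <= c -> c * fine (mu setT) <= eta / 2 ->
  (forall n, is_density mu (fun A => nu A (z n)) (f n)) ->
  (forall n, `|z n| <= M) ->
  (\forall x \ae mu, exists n, forall m, (n <= m)%N -> f m x <= c) ->
  exists n, nu A0 (z n) < eta.
Proof.
move=> mA0 eta0 c0 c_eta fz zM aef.
have M0 : 0 <= M := le_trans (normr_ge0 (z 0%N)) (zM 0%N).
have e0 : 0 < eta / (2 * (M + 1)) by rewrite divr_gt0// mulr_gt0// ltr_wpDl.
have [delta delta0 nu_delta] := nu_continuous e0.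
pose E n := [set x | forall m, (n <= m)%N -> f m x <= c].
have mE n : measurable (E n).
  have -> : E n = \bigcap_(m in [set m | (n <= m)%N]) ~` [set x | c < f m x].
    by apply/seteqP; split => x Ex m nm; have := Ex m nm; rewrite /= leNgt => /negP.
  apply: bigcap_measurable => [|m _]; first by exists n => /=.
  by apply/measurableC/measurable_lt => //; case: (fz m).
have Emono n m : (n <= m)%N -> E n `<=` E m.
  by move=> nm x Ex k mk; apply: Ex; exact: leq_trans mk.
have [n muEn] := measure_eventually_small delta0 mE Emono aef.
exists n; rewrite (density_split (fz n) mA0 (mE n)).
have mI := measurableI A0 (E n) mA0 (mE n); have mD := measurableD mA0 (mE n).
have small1 : nu (A0 `&` E n) (z n) <= eta / 2.
  apply: le_trans c_eta; apply: le_trans (density_le (c := c) (fz n) mI _) _.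
    by move=> x [_ Ex]; exact: Ex.
  by rewrite ler_wpM2l// fine_le ?fin_num_measure// le_measure ?inE.
suff : nu (A0 `\` E n) (z n) < eta / 2 by move: small1; lra.
apply: le_lt_trans (ler_norm _) _; apply: le_lt_trans (dual_bound _ _) _.
have muD : (mu (A0 `\` E n) < delta%:E)%E.
  by apply: le_lt_trans muEn; apply: le_measure; rewrite ?inE//; exact: measurableC.
have M1 : 0 < M + 1 by rewrite ltr_wpDl.
have nuD : `|nu (A0 `\` E n)| * (M + 1) < eta / 2.
  have := nu_delta _ mD muD.
  by rewrite ltr_pdivlMr ?mulr_gt0//; lra.
apply: le_lt_trans nuD; rewrite ler_wpM2l//.
by apply: le_trans (zM n) _; rewrite lerDl.
Qed.

(** By contradiction, as in the overview, whose notations [C], [f], [z], [A],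
    [x], [z'], [y] and [g] are kept. *)
Lemma compact_approximation (K : set Z) (A0 : set Omega) (eta : R) :
  abs_convex_sigma_compact X K -> measurable A0 -> 0 < eta ->
  exists x : subsp X, forall z, K z -> `|nu A0 z - subsp_val x z| <= 2 * eta.
Proof.
move=> [acK cK] mA0 eta0; apply: contrapT => nox.
have [z0 Kz0] : K !=set0.
  by apply/set0P/eqP => K0; apply: nox; exists 0 => z; rewrite K0.
have K0 := abs_convex0 acK Kz0.
have [M M0 KM] := sigma_compact_bounded X_closed X_norming cK.
have [S S0 nuS] := measure_continuous_bounded nu_additive nu_continuous.
(* Elements of s can be rescaled, so the bound 1 describes all basic
   sigma(Z,X)-neighbourhoods of 0; concatenation of lists makes the family C
   directed downwards. *)
pose C (s : seq (subsp X)) : set Z := [set z |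
  [/\ K z, {in s, forall x : subsp X, `|subsp_val x z| <= 1} & eta <= nu A0 z]].
have C_nonempty s : C s !=set0.
  apply: contrapT => Cs; apply: nox.
  apply: (finite_separation (s := s) acK K0 M0 KM eta0) => z Kz sz.
  by rewrite ltNge; apply/negP => etaz; apply: Cs; exists z.
have C_catl s t : C (s ++ t) `<=` C s.
  by move=> z [Kz sz etaz]; split=> // x xs; apply: sz; rewrite mem_cat xs.
have C_catr s t : C (s ++ t) `<=` C t.
  by move=> z [Kz sz etaz]; split=> // x xs; apply: sz; rewrite mem_cat xs orbT.
have midE (g : dual Z) y z : g (2^-1 *: (y + z)) = (g y + g z) / 2.
  by rewrite linearZ linearD /= [LHS]mulrC.
have C_mid s y z : C s y -> C s z -> C s (2^-1 *: (y + z)).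
  move=> [Ky sy etay] [Kz sz etaz]; split.
  - have := (convex_setE K).1 acK.1 y z 2^-1.
    rewrite (_ : 1 - 2^-1 = 2^-1); last by field.
    by rewrite -scalerDr; apply=> //; lra.
  - move=> x xs; have := sy x xs; have := sz x xs.
    by rewrite midE !ler_norml => /andP[? ?] /andP[? ?]; lra.
  - by rewrite midE; lra.
have [f fd] := choice (density_exists nu_additive nu_continuous).
have mf z : measurable_fun setT (f z) by case: (fd z).
pose Phi z := energy mu (f z).
have Phi_bounds s z : C s z -> 0 <= Phi z <= fine (mu setT) + 2 * (S * M).
  move=> [Kz _ _]; apply: energy_bounds (fd z) _ => A mA.
  by apply: (le_trans (dual_bound _ _)); rewrite ler_pM ?nuS ?KM.
have [D [D_inf D_near]] := near_minimizers [::] C_nonempty Phi_bounds.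
(* The factor 16 is the constant of energy_gap; 8 ^ - n is the decay required
   by borel_cantelli_L2. *)
pose e n : R := (16 * 8 ^+ n)^-1.
have e0 n : 0 < e n by rewrite invr_gt0 mulr_gt0 ?exprn_gt0.
have eS n : e n.+1 <= e n.
  rewrite lef_pV2 ?posrE ?mulr_gt0 ?exprn_gt0// ler_pM2l// exprS.
  by rewrite ler_peMl ?exprn_ge0// ler1n.
have [s s_inf] := choice (fun n => D_inf (e n) (e0 n)).
have gap n y z : C (s n) y -> C (s n) z -> Phi y <= D + e n -> Phi z <= D + e n ->
    \int[mu]_x (direction (f y x) - direction (f z x)) ^+ 2 <= (8 ^+ n)^-1.
  move=> Cy Cz yD zD.
  have -> : (8 ^+ n)^-1 = 16 * e n :> R by rewrite /e invfM mulrA divff// mul1r.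
  apply: (energy_gap (fd y) (fd z) _ yD zD (s_inf n _ (C_mid _ _ _ Cy Cz))).
  have := fd (2^-1 *: (y + z)); congr (is_density _ _ _).
  by apply/funext => A; rewrite midE.
(* Membership for both s n and s n.+1 lets z n and z n.+1 compete in C (s n.+1),
   so consecutive densities are close. *)
have [z /all_and2[Cz zD]] :=
  choice (fun n => (exists2P _ _).1 (D_near (e n.+1) (s n ++ s n.+1) (e0 n.+1))).
have aez : \forall x \ae mu, exists n0, forall n, (n0 <= n)%N ->
    `|direction (f (z n) x) - direction (f (z n.+1) x)| <= (2 ^+ n)^-1.
  apply: (borel_cantelli_L2 (M := 2)) => [n|n x|n].
  - exact: measurable_direction_gap.
  - exact: direction_gap_norm.
  apply: le_trans (gap n.+1 _ _ _ _ _ _) _.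
  - exact: C_catr (Cz n).
  - exact: C_catl (Cz n.+1).
  - exact: zD.
  - by rewrite (le_trans (zD n.+1))// lerD2l.
  rewrite lef_pV2 ?posrE ?exprn_gt0// exprS.
  by rewrite ler_peMl ?exprn_ge0// ler1n.
(* With this c, densities that are eventually at most 2 c give values of nu A0
   of order eta / 2, too small for the points z n. *)
pose c := eta / (4 * (fine (mu setT) + 1)).
have muT0 : 0 <= fine (mu setT) by rewrite fine_ge0.
have c0 : 0 < c by rewrite divr_gt0// mulr_gt0// ltr_wpDl.
pose A := [set x | exists n, forall m, (n <= m)%N -> c < f (z m) x].
have mA : measurable A.
  have -> : A = \bigcup_n \bigcap_(m in [set m | (n <= m)%N]) [set x | c < f (z m) x].
    by apply/seteqP; split => [x [n nx]|x [n _ nx]]; exists n.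
  apply: bigcup_measurable => n _; apply: bigcap_measurable; first by exists n => /=.
  by move=> m _; exact: measurable_lt.
have muA : (0 < mu A)%E.
  rewrite lt_neqAle measure_ge0 andbT eq_sym; apply/eqP => muA0.
  have A_null : mu.-negligible A by exact/negligibleP.
  have [|||||n] := @eventually_small_value A0 (fun n => f (z n)) z M eta (2 * c) mA0 eta0.
  - by rewrite mulr_ge0// ltW.
  - have : c * (4 * (fine (mu setT) + 1)) = eta.
      by rewrite divfK// gt_eqF// mulr_gt0// ltr_wpDl.
    by move: c0; lra.
  - by move=> n; exact: fd.
  - by move=> n; apply: KM; case: (Cz n).
  - have {}A_null : \forall x \ae mu, ~ A x.
      by apply: negligibleS A_null => x /= /contrapT.
    apply: filterS2 aez A_null => x [n0 zx] Ax.
    have dc : direction c < direction (2 * c) by rewrite direction_lt; lra.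
    have [[n nx]|[n nx]] := geometric_dichotomy zx dc; exists n => m nm.
      by case: Ax; exists n => k nk; rewrite -direction_lt nx.
    by rewrite leNgt -direction_lt -leNgt nx.
  - by case: (Cz n) => _ _; rewrite leNgt => /negP.
(* The set A depends on the asymptotic behaviour of z alone; x can be imposed as
   a constraint afterwards without changing that behaviour. *)
have [x [xA xX]] := nu_average mA muA.
pose x' : subsp X := Subsp xX.
have [z' /all_and2[Cz' zD']] := choice (fun n =>
  (exists2P _ _).1 (D_near (e n) (s n ++ [:: n.+1%:R *: x']) (e0 n))).
have xz' n : `|x (z' n)| <= n.+1%:R^-1.
  have [_ /(_ (n.+1%:R *: x')) + _] := C_catr _ _ _ (Cz' n).
  rewrite inE eqxx => /(_ isT); rewrite subsp_scaleE normrM normr_nat.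
  by rewrite -ler_pdivlMl ?ltr0n// mulr1.
have aez' : \forall w \ae mu, exists n0, forall n, (n0 <= n)%N ->
    `|direction (f (z n) w) - direction (f (z' n) w)| <= (2 ^+ n)^-1.
  apply: (borel_cantelli_L2 (M := 2)) => [n|n w|n].
  - exact: measurable_direction_gap.
  - exact: direction_gap_norm.
  apply: gap; [exact: C_catl (Cz n)|exact: C_catl (Cz' n)| |exact: zD'].
  by rewrite (le_trans (zD n))// lerD2l.
pose E n := [set w | forall m, (n <= m)%N -> c / 2 < f (z' m) w].
have mE n : measurable (E n).
  have -> : E n = \bigcap_(m in [set m | (n <= m)%N]) [set w | c / 2 < f (z' m) w] by [].
  apply: bigcap_measurable; first by exists n => /=.
  by move=> m _; exact: measurable_lt.
(* The direction of f (z' n) is asymptotic to that of f (z n), which exceeds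
   direction c; the loss from c to c / 2 absorbs the error 2 ^ - n. *)
have AE : \forall w \ae mu, A w -> exists n, E n w.
  apply: filterS aez' => w [n0 zw] [n1 Aw].
  have dc : 0 < direction c - direction (c / 2) by rewrite subr_gt0 direction_lt; lra.
  have [n2 n2c] := half_pow_small dc.
  exists (maxn n0 (maxn n1 n2)) => m; rewrite !geq_max => /and3P[n0m n1m n2m].
  rewrite -direction_lt; have := zw m n0m; have := n2c m n2m.
  have : direction c < direction (f (z m) w) by rewrite direction_lt Aw.
  by rewrite ler_distl => ? ? /andP[]; lra.
have Kz' n : K (z' n) by case: (Cz' n).
have [y Ky yz'] := sigma_compact_cluster cK Kz'.
pose B := A `&` [set w | f y w < c / 4].
have mB : measurable B by apply: measurableI => //; exact: measurable_lt.
(* Test the cluster point against an element g of X attached to a part of B on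
   which all late densities f (z' m) exceed c / 2 simultaneously. *)
have muB : mu B = 0%E.
  apply/eqP; rewrite eq_le measure_ge0 andbT leNgt; apply/negP => muB.
  have BE : \forall w \ae mu, B w -> exists n, E n w.
    by apply: filterS AE => w + [Aw _]; exact.
  have [n muBE] := measure_eventually_gt0 mB muB mE BE.
  have mBE : measurable (B `&` E n) by exact: measurableI.
  have [g [gBE gX]] := nu_average mBE muBE.
  have gz' m : (n <= m)%N -> c / 2 <= g (z' m).
    move=> nm; apply: average_ge gBE => G mG GBE.
    by apply: density_ge (fd _) mG _ => w /GBE[_ Ew]; rewrite ltW// Ew.
  have gy : g y <= c / 4.
    apply: average_le gBE => G mG GBE.
    by apply: density_le (fd _) mG _ => w /GBE[[_ +] _] => /ltW.
  have c4 : 0 < c / 4 by rewrite divr_gt0.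
  have [m nm] := yz' (Subsp gX) (c / 4) n c4.
  by have := gz' m nm; rewrite /= ltr_distl => + /andP[]; lra.
have xy : c / 4 <= x y.
  apply: average_ge xA => G mG GA; apply: (density_ge_ae (fd y) mG).
  apply/eqP; rewrite eq_le measure_ge0 andbT -muB le_measure ?inE//.
    by apply: measurableI => //; exact: measurable_lt.
  exact: setSI.
have c8 : 0 < c / 8 by rewrite divr_gt0.
have [n nc] : exists n, forall m, (n <= m)%N -> m.+1%:R^-1 < c / 8.
  exists (Num.bound (c / 8)^-1) => m nm.
  rewrite -[c / 8]invrK ltf_pV2 ?posrE ?invr_gt0//.
  apply: (lt_trans (archi_boundP _)); first by rewrite invr_ge0 ltW.
  by rewrite ltr_nat ltnS.
have [m nm xm] := yz' x' (c / 8) n c8.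
have {xm} : x y - c / 8 < x (z' m).
  by have : `|(x (z' m) : R) - x y| < c / 8 := xm; rewrite ltr_distl => /andP[].
have xm : x (z' m) < c / 8.
  exact: le_lt_trans (ler_norm _) (le_lt_trans (xz' m) (nc m nm)).
by move: xy xm; lra.
Qed.

End CompactApproximation.

(** * The theorem *)

Theorem theorem3 (R : realType) (d : measure_display)
    (Omega : measurableType d) (mu : {finite_measure set Omega -> \bar R})
    (Z : completeNormedModType R) (X : submodClosed (dual Z))
    (X_closed : closed [set x : dual Z | x \in X])
    (X_norming : norming X)
    (X_cbc : dual_ball_convex_block_compact (subsp X))
    (X_complete : complete_uniform (mackey X))
    (nu : set Omega -> dual Z)
    (nu_additive : countably_additive nu)
    (nu_continuous : measure_continuous mu nu)
    (nu_average : forall A : set Omega, measurable A -> (0 < mu A)%E ->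
      closure (convex_hull (average_range mu nu A) : set (weak_star Z))
        `&` [set x : dual Z | x \in X] !=set0) :
  forall A : set Omega, measurable A -> nu A \in X.
Proof.
move=> A mA; apply: (mackey_complete_mem X_complete) => K e KK e0.
have e2 : 0 < e / 2 by rewrite divr_gt0.
have [x xK] := compact_approximation X_closed X_norming nu_additive nu_continuous
  nu_average KK mA e2.
by exists x => z Kz; have := xK z Kz; rewrite mulrC divfK.
Qed.
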